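(* Let $T=C$ (the Cesàro operator) or $T=C^*$ (the Copson operator), let $I=[0,1]$ or $I=[0,\infty)$, and let $X$ be a Banach function space on $I$ such that $TX\ne\{0\}$. Then $TX$ contains a complemented almost isometric copy of $\ell^1$. In particular, $TX$ is not reflexive.
   Context: $L^0(I)$ is the space of (a.e. equivalence classes of) real-valued Lebesgue measurable functions on $I$. A Banach function space $X$ on $I$ is a Banach space that is a linear subspace of $L^0(I)$ with the ideal property: $|f|\le|g|$ a.e., $f\in L^0(I)$, $g\in X$ imply $f\in X$ and $\|f\|_X\le\|g\|_X$; by convention $X$ is also assumed to contain a function positive a.e. on $I$ (this is not assumed for the derived space $TX$). Cesàro operator: $Cf(x)=\frac1x\int_0^x f(t)\,dt$ for $0<x\in I$. Copson operator: $C^*f(x)=\int_{I\cap[x,\infty)}\frac{f(t)}{t}\,dt$ for $x\in I$. For $T\in\{C,C^*\}$: $TX=\{f\in L^0(I): T|f|\in X\}$ with norm $\|f\|_{TX}=\|T|f|\|_X$. A Banach space $E$ contains an almost isometric copy of $\ell^1$ if for every $0<\varepsilon<1$ there is a sequence $(x_n)\subset E$ with $(1-\varepsilon)\sum_{n}|\alpha_n|\le\|\sum_n\alpha_nx_n\|_E\le\sum_n|\alpha_n|$ for all $(\alpha_n)\in\ell^1$; the copy is complemented if, for every $\varepsilon$, the sequence can be chosen so that its closed linear span is a complemented subspace of $E$. *)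

(* Defs.v *)
From HB Require Import structures.
From mathcomp Require Import all_boot all_order all_algebra generic_quotient.
From mathcomp Require Import all_classical all_reals all_analysis measurable_realfun.

Set Implicit Arguments.
Unset Strict Implicit.
Unset Printing Implicit Defensive.

Import Order.TTheory GRing.Theory Num.Def Num.Theory.
Import numFieldNormedType.Exports.

Local Open Scope classical_set_scope.
Local Open Scope ring_scope.

Lemma filterS4 T (F : set_system T) (FF : Filter F) (P1 P2 P3 P4 Q : set T) :
  (forall t, P1 t -> P2 t -> P3 t -> P4 t -> Q t) ->
  F P1 -> F P2 -> F P3 -> F P4 -> F Q.
Proof.
by move=> h F1 F2 F3 F4; apply: filterS2 (filterI F1 F2) (filterI F3 F4);
  move=> t [? ?] [? ?]; exact: h.
Qed.

Lemma filterS5 T (F : set_system T) (FF : Filter F) (P1 P2 P3 P4 P5 Q : set T) :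
  (forall t, P1 t -> P2 t -> P3 t -> P4 t -> P5 t -> Q t) ->
  F P1 -> F P2 -> F P3 -> F P4 -> F P5 -> F Q.
Proof.
move=> h F1 F2 F3 F4 F5; apply: filterS3 (filterI F1 F2) (filterI F3 F4) F5.
by move=> t [? ?] [? ?]; exact: h.
Qed.

Variant domain := UnitInterval | HalfLine.

Section L0.
Context {R : realType}.
Implicit Types I : domain.

Definition itv_of I : interval R :=
  match I with UnitInterval => `[0, 1] | HalfLine => `[0, +oo[ end.

Definition dom I : set (measurableTypeR R) := [set` itv_of I].

Lemma measurable_dom I : measurable (dom I).
Proof. exact: measurable_itv. Qed.

Definition lebesgue_on I : {measure set (measurableTypeR R) -> \bar R} :=
  mrestr (@lebesgue_measure R) (measurable_dom I).

#[global] Instance ae_lebesgue_on_filter I :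
  Filter (nbhs (almost_everywhere (lebesgue_on I))).
Proof. exact: ae_filter_ringOfSetsType. Qed.

(* The library's quotient of the Borel measurable functions by a.e. equality. As
   every Lebesgue measurable function is a.e. equal to a Borel one, it is also
   the quotient of the Lebesgue measurable functions. The functions live on all
   of R, but their values outside I are irrelevant to the class. *)
Definition L0 I : Type :=
  {mfun_ (lebesgue_on I), measurableTypeR R >-> R}.

HB.instance Definition _ I := Choice.on (L0 I).
HB.instance Definition _ I := EqQuotient.on (L0 I).

Local Open Scope quotient_scope.

Definition toL0 I (f : {mfun measurableTypeR R >-> R}) : L0 I :=
  \pi_(L0 I) f.
Definition ofL0 I (f : L0 I) : measurableTypeR R -> R :=
  (repr f : {mfun _ >-> R}).
Coercion ofL0 : L0 >-> Funclass.

Lemma L0P I (f g : L0 I) : f = g <-> (f = g %[ae lebesgue_on I]).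
Proof.
split=> [->|fg]; first exact: aeW.
rewrite -[f]reprK -[g]reprK; apply/eqmodP/asboolP.
exact: fg.
Qed.

Lemma toL0K I f : \forall t \ae lebesgue_on I, toL0 I f t = f t.
Proof.
by have /eqmodP/asboolP := reprK (toL0 I f); apply: filterS => t; apply.
Qed.

Definition L0_zero I : L0 I := toL0 I (cst 0).
Definition L0_opp I (f : L0 I) : L0 I := toL0 I (- repr f : {mfun _ >-> R}).
Definition L0_add I (f g : L0 I) : L0 I := toL0 I (repr f + repr g : {mfun _ >-> R}).
Definition L0_scale I (a : R) (f : L0 I) : L0 I := toL0 I (a *: repr f : {mfun _ >-> R}).


Lemma L0_oppE I (f : L0 I) : \forall t \ae lebesgue_on I, L0_opp f t = - f t.
Proof. exact: (toL0K I (- repr f : {mfun _ >-> R})). Qed.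

Lemma L0_addE I (f g : L0 I) :
  \forall t \ae lebesgue_on I, L0_add f g t = f t + g t.
Proof. exact: (toL0K I (repr f + repr g : {mfun _ >-> R})). Qed.

Lemma L0_zeroE I : \forall t \ae lebesgue_on I, L0_zero I t = 0.
Proof. exact: (toL0K I (cst 0)). Qed.

Lemma L0_scaleE I a (f : L0 I) :
  \forall t \ae lebesgue_on I, L0_scale a f t = a * f t.
Proof. exact: (toL0K I (a *: repr f : {mfun _ >-> R})). Qed.

Lemma L0_addA I : associative (@L0_add I).
Proof.
move=> f g h; apply/L0P.
have := L0_addE f (L0_add g h); have := L0_addE (L0_add f g) h.
have := L0_addE f g; have := L0_addE g h.
apply: filterS4 => t e1 e2 e3 e4 _.
by rewrite e4 e1 e3 e2 addrA.
Qed.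

Lemma L0_addC I : commutative (@L0_add I).
Proof.
move=> f g; apply/L0P; have := L0_addE f g; have := L0_addE g f.
by apply: filterS2 => t e1 e2 _; rewrite e1 e2 addrC.
Qed.

Lemma L0_add0 I : left_id (L0_zero I) (@L0_add I).
Proof.
move=> f; apply/L0P; have := L0_addE (L0_zero I) f; have := L0_zeroE I.
by apply: filterS2 => t e1 e2 _; rewrite e2 e1 add0r.
Qed.

Lemma L0_addN I : left_inverse (L0_zero I) (@L0_opp I) (@L0_add I).
Proof.
move=> f; apply/L0P; have := L0_addE (L0_opp f) f.
have := L0_oppE f; have := L0_zeroE I.
by apply: filterS3 => t e1 e2 e3 _; rewrite e3 e2 e1 addNr.
Qed.

HB.instance Definition _ I :=
  GRing.isZmodule.Build (L0 I) (@L0_addA I) (@L0_addC I) (@L0_add0 I) (@L0_addN I).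

Lemma L0_scaleA I a b (f : L0 I) :
  L0_scale a (L0_scale b f) = L0_scale (a * b) f.
Proof.
apply/L0P; have := L0_scaleE a (L0_scale b f); have := L0_scaleE b f.
have := L0_scaleE (a * b) f.
by apply: filterS3 => t e1 e2 e3 _; rewrite e1 e3 e2 mulrA.
Qed.

Lemma L0_scale1 I : left_id 1 (@L0_scale I).
Proof.
move=> f; apply/L0P; have := L0_scaleE 1 f.
by apply: filterS => t -> _; rewrite mul1r.
Qed.

Lemma L0_scaleDr I : right_distributive (@L0_scale I) +%R.
Proof.
move=> a f g; apply/L0P; have := L0_scaleE a (f + g).
have := L0_addE (L0_scale a f) (L0_scale a g); have := L0_addE f g.
have := L0_scaleE a f; have := L0_scaleE a g.
by apply: filterS5 => t e1 e2 e3 e4 e5 _; rewrite e5 e4 e3 e2 e1 mulrDr.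
Qed.

Lemma L0_scaleDl I f : {morph (@L0_scale I)^~ f : a b / a + b}.
Proof.
move=> a b; apply/L0P; have := L0_scaleE (a + b) f.
have := L0_addE (L0_scale a f) (L0_scale b f).
have := L0_scaleE a f; have := L0_scaleE b f.
by apply: filterS4 => t e1 e2 e3 e4 _; rewrite e4 e3 e2 e1 mulrDl.
Qed.

HB.instance Definition _ I := GRing.Zmodule_isLmodule.Build R (L0 I)
  (@L0_scaleA I) (@L0_scale1 I) (@L0_scaleDr I) (@L0_scaleDl I).

Lemma L0DE I (f g : L0 I) : \forall t \ae lebesgue_on I, (f + g : L0 I) t = f t + g t.
Proof. exact: L0_addE. Qed.

Lemma L00E I : \forall t \ae lebesgue_on I, (0 : L0 I) t = 0.
Proof. exact: L0_zeroE. Qed.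

Lemma L0ZE I a (f : L0 I) : \forall t \ae lebesgue_on I, (a *: f : L0 I) t = a * f t.
Proof. exact: L0_scaleE. Qed.

Lemma measurable_L0 I (f : L0 I) : measurable_fun setT f.
Proof. exact: measurable_funPT. Qed.

(* A linear subspace of L0 I with a norm; the values of [nsub_norm] outside the
   subspace are irrelevant. *)
Record normedSubspace I := NormedSubspace {
  nsub_set :> set (L0 I);
  nsub_norm : L0 I -> R;
  nsub0 : nsub_set 0;
  nsubP : forall a f g, nsub_set f -> nsub_set g -> nsub_set (a *: f + g);
  nsub_normD : forall f g, nsub_set f -> nsub_set g ->
    nsub_norm (f + g) <= nsub_norm f + nsub_norm g;
  nsub_normZ : forall a f, nsub_set f ->
    nsub_norm (a *: f) = `|a| * nsub_norm f;
  nsub_norm0 : forall f, nsub_set f -> nsub_norm f = 0 -> f = 0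
}.

End L0.


Section normedSubspace_type.
Context {R : realType} {I : domain}.
Variable X : @normedSubspace R I.

Definition nsub_pred : {pred L0 I} := mem (nsub_set X).

Lemma nsub_pred_submod : submod_closed nsub_pred.
Proof.
split=> [|a f g]; rewrite !inE; first exact: nsub0.
exact: nsubP.
Qed.

HB.instance Definition _ :=
  GRing.isSubmodClosed.Build R (L0 I) nsub_pred nsub_pred_submod.

(* The subspace as a type, with the normed module structure given by its norm. *)
Definition space_of : Type := {f : @L0 R I | f \in nsub_pred}.

HB.instance Definition _ := [isSub of space_of for @sval _ _].
HB.instance Definition _ := [Choice of space_of by <:].
HB.instance Definition _ := [SubChoice_isSubLmodule of space_of by <:].

Lemma space_ofP (f : space_of) : nsub_set X (val f).
Proof. by have := valP f; rewrite inE. Qed.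

Let norm (f : space_of) : R := nsub_norm X (val f).

Let norm_normD f g : norm (f + g) <= norm f + norm g.
Proof. by rewrite /norm raddfD; apply: nsub_normD; exact: space_ofP. Qed.

Let norm_normZ a f : norm (a *: f) = `|a| * norm f.
Proof. by rewrite /norm linearZ/=; apply: nsub_normZ; exact: space_ofP. Qed.

Let norm_norm0 f : norm f = 0 -> f = 0.
Proof.
by move=> f0; apply: val_inj => /=; apply: nsub_norm0 f0; exact: space_ofP.
Qed.

HB.instance Definition _ :=
  Lmodule_isNormed.Build R space_of norm_normD norm_normZ norm_norm0.

End normedSubspace_type.

Record banachFunctionSpace (R : realType) (I : domain) := BanachFunctionSpace {
  bfs_sub :> @normedSubspace R I;
  bfs_complete : forall F : set_system (space_of bfs_sub),
    ProperFilter F -> cauchy F -> cvg F;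
  bfs_ideal : forall f g : L0 I,
    (\forall t \ae lebesgue_on I, `|f t| <= `|g t|) ->
    nsub_set bfs_sub g ->
    nsub_set bfs_sub f /\ nsub_norm bfs_sub f <= nsub_norm bfs_sub g;
  bfs_pos : exists2 f : L0 I, nsub_set bfs_sub f &
    \forall t \ae lebesgue_on I, 0 < f t
}.

HB.instance Definition _ (R : realType) I (X : banachFunctionSpace R I) :=
  Uniform_isComplete.Build (space_of X) (@bfs_complete R I X).

Variant hardy_op := Cesaro | Copson.

Section hardy.
Context {R : realType}.
Implicit Types (I : domain) (T : hardy_op).

(* Only used for f >= 0, where the integrals always make sense in [0, +oo].
   At the single point x = 0, where [0^-1 = 0], Cesaro takes a junk value. *)
Definition hardy I T (f : R -> R) (x : R) : \bar R :=
  match T with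
  | Cesaro => ((x^-1)%:E * \int[lebesgue_measure]_(t in `[0%R, x]) (f t)%:E)%E
  | Copson =>
      (\int[lebesgue_measure]_(t in dom I `&` `[x, +oo[) (f t / t)%:E)%E
  end.

Definition Tabs I T (f : L0 I) (x : R) : \bar R := hardy I T (fun t => `|f t|) x.

(* g is the class of T|f|; in particular T|f| is finite a.e. *)
Definition is_absT I T (f g : L0 I) : Prop :=
  \forall x \ae lebesgue_on I, Tabs T f x = (g x)%:E.

(* Both operators have the form x |-> c(x) \int_(D x) w(t) f(t) dt. *)
Definition hcoef T (x : R) : R := if T is Cesaro then x^-1 else 1.
Definition hwt T (t : R) : R := if T is Cesaro then 1 else t^-1.
Definition hdom I T (x : R) : set R :=
  if T is Cesaro then `[0, x] else dom I `&` `[x, +oo[.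

Lemma TabsE I T (f : L0 I) x :
  Tabs T f x = ((hcoef T x)%:E *
    \int[lebesgue_measure]_(t in hdom I T x) (hwt T t * `|f t|)%:E)%E.
Proof.
case: T; rewrite /Tabs /hardy /hcoef /hwt /hdom.
  by congr (_ * _)%E; apply: eq_integral => t _; rewrite mul1r.
by rewrite mul1e; apply: eq_integral => t _; rewrite mulrC.
Qed.

Lemma measurable_hdom I T x : measurable (hdom I T x : set (measurableTypeR R)).
Proof.
case: T; first exact: measurable_itv.
by apply: measurableI; [exact: measurable_dom|exact: measurable_itv].
Qed.

Lemma dom_ge0 I (x : R) : dom I x -> 0 <= x.
Proof. by case: I; rewrite /dom/= in_itv/= => /andP[]. Qed.

Lemma hdom_ge0 I T x t : hdom I T x t -> 0 <= t.
Proof. by case: T => /= [|[/dom_ge0//]]; rewrite in_itv/= => /andP[]. Qed.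

Lemma hdom_dom I T x : dom I x -> hdom I T x `<=` dom I.
Proof.
case: T => /= [|_ t []//]; case: I => /=; rewrite /dom/= !in_itv/=.
  by move=> /andP[_ x1] t /=; rewrite !in_itv/= => /andP[-> /le_trans]; apply.
by move=> _ t /=; rewrite !in_itv/= => /andP[->].
Qed.

Lemma hwt_ge0 I T x t : hdom I T x t -> 0 <= hwt T t.
Proof. by move=> /hdom_ge0; case: T => //=; rewrite invr_ge0. Qed.

Lemma hcoef_ge0 T x : 0 <= x -> 0 <= hcoef T x.
Proof. by case: T => //=; rewrite invr_ge0. Qed.

Lemma hcoef_gt0 T x : 0 < x -> 0 < hcoef T x.
Proof. by case: T => //=; rewrite invr_gt0. Qed.

Lemma hwt_neq0 T t : t != 0 -> hwt T t != 0.
Proof. by case: T => /=; [rewrite oner_eq0|rewrite invr_eq0]. Qed.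


Lemma hwt_powR T t : 0 <= t ->
  hwt T t = (if T is Cesaro then 1 else t `^ (-1)).
Proof. by case: T => //= t0; rewrite powR_inv1. Qed.

Lemma hcoef_powR T t : 0 <= t ->
  hcoef T t = (if T is Cesaro then t `^ (-1) else 1).
Proof. by case: T => //= t0; rewrite powR_inv1. Qed.

Lemma measurable_hwt I T x : measurable_fun (hdom I T x) (hwt T).
Proof.
pose g T t : R := if T is Cesaro then 1 else t `^ (-1).
apply: (eq_measurable_fun (g T)).
  by move=> t; rewrite inE => /hdom_ge0 t0; rewrite hwt_powR.
apply: measurable_funTS; case: T => /=; first exact: measurable_cst.
exact: measurable_powR.
Qed.

Lemma hint_ge0 I T (f : L0 I) x t : hdom I T x t ->
  (0 <= (hwt T t * `|f t|)%:E)%E.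
Proof. by move=> /hwt_ge0 ?; rewrite lee_fin mulr_ge0. Qed.

Lemma measurable_hint I T (f : L0 I) x :
  measurable_fun (hdom I T x) (fun t => (hwt T t * `|f t|)%:E).
Proof.
apply/measurable_EFinP/measurable_funM; first exact: measurable_hwt.
apply: measurable_funTS; apply: measurableT_comp => //.
exact: measurable_L0.
Qed.

Lemma Tabs_ge0 I T (f : L0 I) x : dom I x -> (0 <= Tabs T f x)%E.
Proof.
move=> /dom_ge0 x0; rewrite TabsE mule_ge0// ?lee_fin ?hcoef_ge0//.
by apply: integral_ge0 => t; exact: hint_ge0.
Qed.

Lemma ae_dom I (P : set R) : (\forall t \ae lebesgue_on I, P t) <->
  (\forall t \ae (@lebesgue_measure R), dom I t -> P t).
Proof.
split=> [[A [mA A0 PA]]|[A [mA A0 PA]]].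
  exists (A `&` dom I); split.
  - by apply: measurableI => //; exact: measurable_dom.
  - exact: A0.
  - by move=> t /not_implyP[It nPt]; split => //; exact: PA.
exists (A `|` ~` dom I); split.
- by apply: measurableU => //; apply: measurableC; exact: measurable_dom.
- rewrite /lebesgue_on /= /mrestr setIUl setICl setU0.
  apply/eqP; rewrite -measure_le0 -A0; apply: le_measure; rewrite ?inE//.
  by apply: measurableI => //; exact: measurable_dom.
- move=> t nPt; have [It|] := pselect (dom I t); last by right.
  by left; apply: PA => /(_ It).
Qed.

Lemma ae_dom_W I : \forall t \ae @lebesgue_on R I, dom I t.
Proof. by apply/ae_dom; exact: aeW. Qed.

Lemma Tabs_le I T (f g : L0 I) :
  (\forall t \ae lebesgue_on I, `|f t| <= `|g t|) ->
  forall x, dom I x -> (Tabs T f x <= Tabs T g x)%E.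
Proof.
move=> /ae_dom fg x Ix; rewrite !TabsE; apply: lee_wpmul2l.
  by rewrite lee_fin hcoef_ge0// (dom_ge0 Ix).
apply: ae_ge0_le_integral.
- exact: measurable_hdom.
- by move=> t; exact: hint_ge0.
- exact: measurable_hint.
- by move=> t; exact: hint_ge0.
- exact: measurable_hint.
- apply: filterS fg => t fg xt; rewrite lee_fin ler_wpM2l//.
    exact: hwt_ge0 xt.
  exact/fg/(hdom_dom Ix xt).
Qed.

Lemma Tabs_lin I T (a : R) (f g : L0 I) (x : R) : dom I x ->
  (Tabs T (a *: f + g)%R x <= `|a|%:E * Tabs T f x + Tabs T g x)%E.
Proof.
move=> Ix; have x0 := dom_ge0 Ix; rewrite !TabsE.
have hi (h : L0 I) : (0 <= \int[lebesgue_measure]_(t in hdom I T x)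
    (hwt T t * `|h t|)%:E)%E by apply: integral_ge0 => t; exact: hint_ge0.
rewrite (muleCA `|a|%:E) -ge0_muleDr; [|by rewrite mule_ge0|exact: hi].
rewrite -(@ge0_integralZl _ _ _ _ _ _ _ _ `|a|%:E)//; last 3 first.
- exact: measurable_hdom.
- exact: measurable_hint.
- by move=> t; exact: hint_ge0.
rewrite -ge0_integralD; last 5 first.
- exact: measurable_hdom.
- by move=> t xt; rewrite mule_ge0//; exact: hint_ge0 xt.
- by apply: measurable_funeM; exact: measurable_hint.
- by move=> t; exact: hint_ge0.
- exact: measurable_hint.
apply: lee_wpmul2l; first by rewrite lee_fin hcoef_ge0.
apply: ae_ge0_le_integral.
- exact: measurable_hdom.
- by move=> t; exact: hint_ge0.
- exact: measurable_hint.
- by move=> t xt; rewrite adde_ge0 ?mule_ge0//; exact: hint_ge0 xt.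
- apply: emeasurable_funD; last exact: measurable_hint.
  by apply: measurable_funeM; exact: measurable_hint.
- have /ae_dom := L0ZE a f; have /ae_dom := L0DE (a *: f) g.
  apply: filterS2 => t /[swap] e1 /[swap] xt.
  have It := hdom_dom Ix xt; move=> /(_ It) -> ; rewrite (e1 It).
  rewrite -EFinM -EFinD lee_fin mulrCA -mulrDr ler_wpM2l//.
    exact: hwt_ge0 xt.
  by rewrite (le_trans (ler_normD _ _))// normrM.
Qed.

Lemma TabsZ I T (a : R) (f : L0 I) (x : R) : dom I x ->
  (Tabs T (a *: f)%R x = `|a|%:E * Tabs T f x)%E.
Proof.
move=> Ix; have x0 := dom_ge0 Ix; rewrite !TabsE (muleCA `|a|%:E).
rewrite -(@ge0_integralZl _ _ _ _ _ _ _ _ `|a|%:E)//; last 3 first.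
- exact: measurable_hdom.
- exact: measurable_hint.
- by move=> t; exact: hint_ge0.
congr (_ * _)%E; apply: ae_eq_integral.
- exact: measurable_hdom.
- exact: measurable_hint.
- by apply: measurable_funeM; exact: measurable_hint.
- have /ae_dom := L0ZE a f; apply: filterS => t e1 xt.
  by rewrite (e1 (hdom_dom Ix xt)) normrM -EFinM mulrCA.
Qed.

Lemma Tabs0 I T (x : R) : dom I x -> Tabs T (0 : L0 I) x = 0%E.
Proof.
by move=> Ix; rewrite -[0](scale0r (0 : L0 I)) TabsZ// normr0 mul0e.
Qed.

End hardy.

Section derived.
Context {R : realType}.
Implicit Types (I : domain) (T : hardy_op).

Lemma emeasurable_nondecreasing (F : R -> \bar R) :
  {homo F : x y / x <= y >-> (x <= y)%E} -> measurable_fun setT F.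
Proof.
move=> F_nd; apply: (measurability _ (ErealGenCInfty.measurableE R)) => //.
move=> _ [_ [r ->] <-]; rewrite setTI; apply: is_interval_measurable => s t /=.
rewrite !in_itv/= !andbT => rs rt u /andP[su ut].
by rewrite in_itv/= andbT (le_trans rs)// F_nd.
Qed.

Lemma emeasurable_nonincreasing (F : R -> \bar R) :
  {homo F : x y / x <= y >-> (y <= x)%E} -> measurable_fun setT F.
Proof.
move=> F_ni; rewrite (_ : F = (F \o -%R) \o -%R); last first.
  by apply/funext => x /=; rewrite opprK.
apply: measurableT_comp; last exact: oppr_measurable.
by apply: emeasurable_nondecreasing => x y xy /=; rewrite F_ni// lerN2.
Qed.

Lemma measurable_hintegral I T (f : L0 I) : measurable_fun setT
  (fun x => \int[@lebesgue_measure R]_(t in hdom I T x) (hwt T t * `|f t|)%:E)%E.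
Proof.
have le x y : hdom I T x `<=` hdom I T y ->
    (\int[@lebesgue_measure R]_(t in hdom I T x) (hwt T t * `|f t|)%:E <=
     \int[@lebesgue_measure R]_(t in hdom I T y) (hwt T t * `|f t|)%:E)%E.
  move=> xy; apply: ge0_subset_integral => //; try exact: measurable_hdom.
  - exact: measurable_hint.
  - by move=> t; exact: hint_ge0.
case: T le => le.
  apply: emeasurable_nondecreasing => x y xy; apply: le => t /=.
  by rewrite !in_itv/= => /andP[-> /le_trans]; exact.
apply: emeasurable_nonincreasing => x y xy; apply: le => t /= [It].
by rewrite !in_itv/= !andbT => /(le_trans xy).
Qed.

Lemma is_absT_ex I T (f : @L0 R I) :
  (\forall x \ae lebesgue_on I, Tabs T f x < +oo)%E -> exists g, is_absT T f g.
Proof.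
move=> foo.
pose c x : R := if T is Cesaro then x `^ (-1) else 1.
pose u x := fine ((c x)%:E *
  \int[@lebesgue_measure R]_(t in hdom I T x) (hwt T t * `|f t|)%:E)%E.
have mu : @measurable_fun _ _ (measurableTypeR R) R setT u.
  apply: measurableT_comp => //; apply: emeasurable_funM.
    apply/measurable_EFinP; rewrite /c; case: (T).
      exact: measurable_powR.
    exact: measurable_cst.
  exact: measurable_hintegral.
pose v : {mfun measurableTypeR R >-> R} :=
  @mfun_Sub _ _ (measurableTypeR R) R u (mem_set mu).
exists (toL0 I v).
have := toL0K I v; move: foo (@ae_dom_W R I).
rewrite /is_absT; apply: filterS3 => x foo Ix -> /=.
rewrite /u /c -(hcoef_powR T (dom_ge0 Ix)) -TabsE fineK//.
by rewrite ge0_fin_numE// Tabs_ge0.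
Qed.

Lemma is_absTU I T (f g h : @L0 R I) : is_absT T f g -> is_absT T f h -> g = h.
Proof.
move=> fg fh; apply/L0P; move: fg fh; apply: filterS2 => x -> [] + _.
exact.
Qed.

(* The class of T|f| when there is one, that is, when T|f| is finite a.e. *)
Definition absT I T (f : L0 I) : @L0 R I := xget 0 (is_absT T f).

Lemma absTE I T (f g : @L0 R I) : is_absT T f g -> absT T f = g.
Proof.
move=> fg; rewrite /absT; case: xgetP => [h _ fh|]; first exact: is_absTU fh fg.
by move=> /(_ g).
Qed.

Variables (I : domain) (T : hardy_op) (X : banachFunctionSpace R I).

(* T|f| belongs to X. *)
Definition Tset : set (L0 I) := [set f | exists2 g, is_absT T f g & nsub_set X g].

Definition Tnorm (f : L0 I) : R := nsub_norm X (absT T f).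

Lemma is_absT_dom (f g : L0 I) : nsub_set X g ->
  (\forall x \ae lebesgue_on I, Tabs T f x <= (g x)%:E)%E ->
  exists h, [/\ is_absT T f h, nsub_set X h & nsub_norm X h <= nsub_norm X g].
Proof.
move=> Xg fg; have [|h fh] := @is_absT_ex I T f.
  by apply: filterS fg => x /le_lt_trans; apply; rewrite ltry.
exists h.
have [|Xh hg] := @bfs_ideal R I X h g _ Xg; last by split.
move: fh fg (@ae_dom_W R I); apply: filterS3 => x fh fg Ix.
have := Tabs_ge0 T f Ix; move: fg; rewrite fh !lee_fin => hg h0.
by rewrite ger0_norm// (le_trans hg)// ler_norm.
Qed.

Lemma Tset0 : Tset 0.
Proof.
exists 0; last exact: nsub0.
have := @L00E R I; have := @ae_dom_W R I; apply: filterS2 => x Ix ->.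
by rewrite Tabs0.
Qed.

Lemma is_absT_lin a (f g f1 g1 : @L0 R I) : is_absT T f f1 -> is_absT T g g1 ->
  (\forall x \ae lebesgue_on I,
    Tabs T (a *: f + g)%R x <= ((`|a| *: f1 + g1 : L0 I)%R x)%:E)%E.
Proof.
move=> ff1 gg1; have := L0DE (`|a| *: f1) g1; have := L0ZE `|a| f1.
move: ff1 gg1 (@ae_dom_W R I); apply: filterS5 => x ff1 gg1 Ix e1 e2.
by rewrite e2 e1 EFinD EFinM -ff1 -gg1 Tabs_lin.
Qed.

Lemma TsetP a (f g : L0 I) : Tset f -> Tset g -> Tset (a *: f + g).
Proof.
move=> [f1 ff1 Xf1] [g1 gg1 Xg1].
have [|h [? ? _]] := is_absT_dom _ (is_absT_lin a ff1 gg1).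
  exact: nsubP.
by exists h.
Qed.

Lemma Tnorm_normD (f g : L0 I) : Tset f -> Tset g -> Tnorm (f + g) <= Tnorm f + Tnorm g.
Proof.
move=> [f1 ff1 Xf1] [g1 gg1 Xg1].
have [|h [hr ? hn]] := is_absT_dom _ (is_absT_lin 1 ff1 gg1).
  exact: nsubP.
move: hr hn; rewrite normr1 !scale1r /Tnorm => /absTE ->.
rewrite (absTE ff1) (absTE gg1) => /le_trans; apply; exact: nsub_normD.
Qed.

Lemma Tnorm_normZ a (f : L0 I) : Tset f -> Tnorm (a *: f) = `|a| * Tnorm f.
Proof.
move=> [f1 ff1 Xf1]; rewrite /Tnorm (absTE ff1).
have <- : nsub_norm X (`|a| *: f1) = `|a| * nsub_norm X f1.
  by rewrite nsub_normZ// normr_id.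
congr nsub_norm; apply: absTE.
have := L0ZE `|a| f1.
move: ff1 (@ae_dom_W R I); apply: filterS3 => x ff1 Ix ->.
by rewrite TabsZ// ff1.
Qed.


End derived.

Section definite.
Context {R : realType}.
Variables (I : domain) (T : hardy_op).

Lemma inv_lt (e : R) : 0 < e -> exists n : nat, (n.+1%:R)^-1 < e.
Proof.
move=> e0; exists (Num.bound e^-1).
rewrite -[ltRHS]invrK ltf_pV2 ?posrE ?invr_gt0//.
rewrite (@lt_le_trans _ _ (Num.bound e^-1)%:R) ?ler_nat//.
by rewrite archi_boundP// invr_ge0 ltW.
Qed.

Definition Jlo (n : nat) : R :=
  match T, I with
  | Cesaro, UnitInterval => 1 - n.+1%:R^-1
  | Cesaro, HalfLine => n%:R
  | Copson, _ => 0
  end.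

Definition Jhi (n : nat) : R :=
  match T, I with
  | Cesaro, UnitInterval => 1
  | Cesaro, HalfLine => n.+1%:R
  | Copson, _ => n.+1%:R^-1
  end.

Lemma invS_le1 n : n.+1%:R^-1 <= 1 :> R.
Proof. by rewrite invf_le1// ler1n. Qed.

Lemma Jlo_ge0 n : 0 <= Jlo n.
Proof. by rewrite /Jlo; case: T => //; case: I => //; rewrite subr_ge0 invS_le1. Qed.

Lemma Jlohi n : Jlo n < Jhi n.
Proof.
rewrite /Jlo /Jhi; case: T; first case: I.
- by rewrite ltrBlDr ltrDl invr_gt0.
- by rewrite ltr_nat.
- by rewrite invr_gt0.
Qed.

Lemma J_dom n (x : R) : Jlo n < x < Jhi n -> dom I x.
Proof.
move=> /andP[lx xh]; have x0 : 0 <= x := le_trans (Jlo_ge0 n) (ltW lx).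
move: xh; rewrite /dom /Jhi; case: I; rewrite /= in_itv/= x0//=.
case: T => [/ltW//|/ltW/le_trans]; apply; exact: invS_le1.
Qed.

Lemma J_cover (t : R) : dom I t -> t != 0 -> t != 1 ->
  exists n, forall x, Jlo n < x < Jhi n -> hdom I T x t.
Proof.
move=> It tn0 tn1; have t0 := dom_ge0 It.
rewrite /Jlo /Jhi /hdom; case: T.
- move: It; case: I => It.
    have t1 : t < 1 by move: It; rewrite /dom/= in_itv/= t0/= lt_neqAle tn1.
    have [|n tn] := @inv_lt (1 - t); first by rewrite subr_gt0.
    exists n => x /andP[nx _]; rewrite /= in_itv/= t0/= ltW// (lt_trans _ nx)//.
    by rewrite ltrBrDl -ltrBrDr.
  exists (Num.bound t) => x /andP[nx _]; rewrite /= in_itv/= t0/= ltW//.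
  by rewrite (lt_trans _ nx)// archi_boundP.
- have [|n tn] := @inv_lt t; first by rewrite lt_neqAle eq_sym tn0.
  exists n => x /andP[_ xn]; split=> //=; rewrite in_itv/= andbT.
  by rewrite ltW// (lt_trans xn).
Qed.

Lemma ae_pick (P : R -> Prop) (a b : R) :
  (\forall x \ae @lebesgue_measure R, P x) -> a < b ->
  exists x, a < x < b /\ P x.
Proof.
move=> [A [mA A0 PA]] ab; apply: contrapT => /forallNP nP.
have : (@lebesgue_measure R `]a, b[%classic <= lebesgue_measure A)%E.
  apply: le_measure; [by apply/mem_set; exact: measurable_itv|exact/mem_set|].
  move=> x /=; rewrite in_itv/= => xab; apply: PA => /= Px.
  by apply: (nP x).
rewrite A0 lebesgue_measure_itv/= lte_fin ab -EFinB lee_fin subr_le0.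
by rewrite leNgt ab.
Qed.

Lemma Tabs_eq0 (f : @L0 R I) :
  (\forall x \ae lebesgue_on I, Tabs T f x = 0%E) -> f = 0.
Proof.
move=> /ae_dom f0.
have /choice[x xP] n : exists x, Jlo n < x < Jhi n /\ (dom I x -> Tabs T f x = 0%E).
  exact: ae_pick f0 (Jlohi n).
have fx n : \forall t \ae @lebesgue_measure R, hdom I T (x n) t -> t != 0 -> f t = 0.
  have [xn /(_ (J_dom xn))] := xP n.
  rewrite TabsE => /eqP; rewrite mule_eq0 eqe gt_eqF/=; last first.
    by apply: hcoef_gt0; rewrite (le_lt_trans (Jlo_ge0 n))//; case/andP: xn.
  move=> /eqP int0.
  have /ae_eq_integral_abs : (\int[@lebesgue_measure R]_(t in hdom I T (x n))
      `|(hwt T t * `|f t|%R)%:E| = 0)%E.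
    rewrite -[RHS]int0; apply: eq_integral => t; rewrite inE => xt.
    by rewrite gee0_abs//; exact: hint_ge0 xt.
  move=> /(_ (measurable_hdom _ _ _) (@measurable_hint R I T f (x n))).
  apply: filterS => t h xt tn0; have /eqP := h xt.
  rewrite /= eqe mulf_eq0 normr_eq0 => /orP[wt0|/eqP//].
  by have := hwt_neq0 T tn0; rewrite wt0.
have ne (a : R) : \forall t \ae @lebesgue_measure R, t != a.
  exists [set a]; split => //; first exact: lebesgue_measure_set1.
  by move=> t /= /negP; rewrite negbK => /eqP.
have allfx := ae_foralln fx.
apply/L0P; have f00 := @L00E R I; have : \forall t \ae lebesgue_on I, f t = 0.
  apply/ae_dom; move: allfx (ne 0) (ne 1); apply: filterS3 => t ft t0 t1 It.
  have [n nP] := J_cover It t0 t1.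
  by apply: (ft n) => //; apply: nP; have [] := xP n.
by move: f00; apply: filterS2 => t -> -> _.
Qed.

Variable X : banachFunctionSpace R I.

Lemma Tnorm_norm0 (f : L0 I) : Tset T X f -> Tnorm T X f = 0 -> f = 0.
Proof.
move=> [f1 ff1 Xf1]; rewrite /Tnorm (absTE ff1) => /(nsub_norm0 Xf1) f10.
apply: Tabs_eq0; move: ff1 (@L00E R I); rewrite /is_absT f10.
by apply: filterS2 => x -> ->.
Qed.

(* The space TX, with the norm f |-> || T|f| ||_X. *)
Definition derived_space : @normedSubspace R I :=
  NormedSubspace (Tset0 T X) (@TsetP R I T X) (@Tnorm_normD R I T X)
    (@Tnorm_normZ R I T X) Tnorm_norm0.

End definite.

Section dual.
Context {R : realType} (E : normedModType R).

Definition dual_pred : {pred E -> R^o} :=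
  mem [set f : E -> R^o | linear f /\ continuous f].

Lemma dual_pred_submod : submod_closed dual_pred.
Proof.
split=> [|a f g]; rewrite !inE/=.
  split=> [b u v|x]; last exact: cvg_cst.
  by rewrite /GRing.zero/= scaler0 addr0.
move=> [lf cf] [lg cg]; split=> [b u v|x].
  rewrite /= !fctE lf lg !scalerDr addrACA; congr (_ + _ + (_ + _)).
  by rewrite !scalerA mulrC.
by apply: cvgD (cg x); apply: cvgZr; exact: cf.
Qed.

HB.instance Definition _ :=
  GRing.isSubmodClosed.Build R (E -> R^o) dual_pred dual_pred_submod.

(* The bounded linear functionals on E, with the operator norm. *)
Definition dual_space : Type := {f : E -> R^o | f \in dual_pred}.
HB.instance Definition _ := [isSub of dual_space for @sval _ _].
HB.instance Definition _ := [Choice of dual_space by <:].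
HB.instance Definition _ := [SubChoice_isSubLmodule of dual_space by <:].

Definition dual_fun (f : dual_space) : E -> R := val f.
Coercion dual_fun : dual_space >-> Funclass.

Lemma dualP (f : dual_space) : linear (f : E -> R^o) /\ continuous (f : E -> R^o).
Proof. by have := valP f; rewrite inE. Qed.

Definition dual_norm (f : dual_space) : R :=
  sup [set `|f x| | x in [set x : E | `|x| <= 1]].

Lemma dual_bounded (f : dual_space) : exists M : R, forall x, `|f x| <= M * `|x|.
Proof.
have [lf cf] := dualP f.
pose g : E -> R^o := f.
pose gm := GRing.isLinear.Build R E R^o *:%R g lf.
pose gL : {linear E -> R^o} := HB.pack g gm.
have /linear_boundedP/pinfty_ex_gt0[M _ gM] :=
  @continuous_linear_bounded R E R^o 0 gL (cf 0).
by exists M.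
Qed.

Lemma dual0 (f : dual_space) : f 0 = 0.
Proof.
have [M fM] := dual_bounded f.
by apply/eqP; rewrite -normr_le0 (le_trans (fM 0))// normr0 mulr0.
Qed.

Lemma dual_has_sup (f : dual_space) :
  has_sup [set `|f x| | x in [set x : E | `|x| <= 1]].
Proof.
have [M fM] := dual_bounded f; split.
  by exists `|f 0|; exists 0 => //=; rewrite normr0.
exists `|M| => _ [x /= x1 <-]; rewrite (le_trans (fM x))//.
rewrite (le_trans (ler_norm _))// normrM normr_id ler_piMr//.
Qed.

Lemma dual_norm_ub (f : dual_space) x : `|x| <= 1 -> `|f x| <= dual_norm f.
Proof.
by move=> x1; apply: ub_le_sup; [have [] := dual_has_sup f|exists x].
Qed.

Lemma dual_norm_le (f : dual_space) M : (forall x, `|x| <= 1 -> `|f x| <= M) ->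
  dual_norm f <= M.
Proof.
move=> fM; apply: ge_sup; first by have [] := dual_has_sup f.
by move=> _ [x /= x1 <-]; exact: fM.
Qed.

Lemma dual_norm_ge0 (f : dual_space) : 0 <= dual_norm f.
Proof. by apply: (le_trans (normr_ge0 (f 0))); apply: dual_norm_ub; rewrite normr0. Qed.

Lemma dual_normD (f g : dual_space) : dual_norm (f + g) <= dual_norm f + dual_norm g.
Proof.
apply: dual_norm_le => x x1.
have -> : dual_fun (f + g) x = f x + g x by rewrite /dual_fun raddfD.
by rewrite (le_trans (ler_normD _ _))// lerD// dual_norm_ub.
Qed.

Lemma dual_norm_leZ (a : R) (f : dual_space) : dual_norm (a *: f) <= `|a| * dual_norm f.
Proof.
apply: dual_norm_le => x x1.
have -> : dual_fun (a *: f) x = a * f x by rewrite /dual_fun linearZ.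
by rewrite normrM ler_wpM2l// dual_norm_ub.
Qed.

Lemma dual_normZ (a : R) (f : dual_space) : dual_norm (a *: f) = `|a| * dual_norm f.
Proof.
apply/le_anti; rewrite dual_norm_leZ/=.
have [->|a0] := eqVneq a 0; first by rewrite normr0 mul0r dual_norm_ge0.
rewrite -ler_pdivlMl ?normr_gt0// -normfV.
by rewrite (le_trans _ (dual_norm_leZ _ _))// scalerA mulVf// scale1r.
Qed.

Lemma dual_norm0 (f : dual_space) : dual_norm f = 0 -> f = 0.
Proof.
move=> f0; apply/val_inj/funext => x /=.
have fb y : `|y| <= 1 -> f y = 0.
  by move=> /(dual_norm_ub f); rewrite f0 normr_le0 => /eqP.
have [->|x0] := eqVneq x 0; first exact: (dual0 f).
have nx : `|x| != 0 by rewrite normr_eq0.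
have := fb (`|x|^-1 *: x); rewrite normrZ normfV normr_id mulVf// lexx.
move=> /(_ isT); have [lf _] := dualP f.
have := lf `|x|^-1 x 0; rewrite addr0 => ->; rewrite dual0 addr0 => /eqP.
by rewrite scaler_eq0 invr_eq0 (negPf nx) => /eqP.
Qed.

HB.instance Definition _ :=
  Lmodule_isNormed.Build R dual_space dual_normD dual_normZ dual_norm0.

End dual.

Section geometry.
Context {R : realType} (E : normedModType R).

(* The canonical embedding v |-> (phi |-> phi v) into the bidual is onto. *)
Definition reflexive_space : Prop :=
  forall Phi : dual_space (dual_space E), exists v : E, forall phi : dual_space E, Phi phi = phi v.

Definition lin_span (x : nat -> E) : set E :=
  [set v | exists n (a : nat -> R), v = \sum_(i < n) a i *: x i].

(* F is the range of a bounded linear projection of E. *)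
Definition complemented (F : set E) : Prop :=
  exists P : {linear E -> E},
    [/\ continuous P, forall v, F (P v) & forall v, F v -> P v = v].

(* Convergence of the series is part of the claim: [limn] is junk otherwise. *)
Definition l1_almost_isometric (e : R) (x : nat -> E) : Prop :=
  forall a : nat -> R, cvgn (series (fun n => `|a n|)) ->
    cvgn (series (fun n => a n *: x n)) /\
    (1 - e) * limn (series (fun n => `|a n|))
      <= `|limn (series (fun n => a n *: x n))|
      <= limn (series (fun n => `|a n|)).

Definition contains_complemented_almost_isometric_l1 : Prop :=
  forall e : R, 0 < e < 1 ->
    exists x : nat -> E,
      l1_almost_isometric e x /\ complemented (closure (lin_span x)).

End geometry.

(* Main.v *)
Require Import Defs.
From HB Require Import structures.
From mathcomp Require Import all_boot all_order all_algebra lra.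
From mathcomp Require Import all_classical all_reals all_analysis measurable_realfun.

(** Both Hardy operators have the form
      T f (x) = hcoef x * \int_(hdom x) hwt(t) f(t) dt,
    with a domain [hdom x] that is monotone in [x]. Concentrate [f] >= 0 near a
    point [c]: then T f is close to (\int hwt f) times the kernel
    [kern c] : x |-> hcoef x * 1_(c \in hdom x). The norm of T X therefore only
    sees the weighted L1 norm of functions living near [c], and T X contains a
    piece that is almost an isometric copy of a space L1, hence of l1.

    Choice of the place. If T X is not zero, [kern c] belongs to X for all [c]
    beyond some [a], and phi(c) = || kern c ||_X is monotone in [c] and bounded
    below by a positive number along a sequence of points converging to some
    [b]. A monotone sequence bounded below cannot lose the proportion [e] at each
    step, so that there are two points c1, c0 with
    (1 - e) phi(c1) <= phi(c0) <= phi(c1) ([exists_window]). For a measurable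
    set B between c0 and c1,
    - every f satisfies  phi(c0) * \int_B hwt |f| <= || f ||_TX
      ([Tnorm_ge_wmass]);
    - if f vanishes off B, then || f ||_TX <= phi(c1) * \int_B hwt |f|
      ([Tnorm_le_wmass]).

    The copy of l1. Take disjoint intervals J_n in the window, let x_n be the
    multiple of 1_(J_n) / hwt such that \int hwt x_n = 1 / phi(c1), and let
    c_n(f) = phi(c1) * \int_(J_n) hwt f. The two inequalities give || x_n || <= 1
    and (1 - e) * \sum_n |c_n(f)| <= || f || for every f in T X, while
    c_i(x_j) = (i == j). The series \sum_n a_n x_n converges in T X when
    \sum_n |a_n| is finite, because its pointwise sum is a step function to
    which the second inequality applies, and so are its remainders
    ([l1_series_cvg]).

    These properties of x_n and c_n suffice in any normed space. The c_n
    bound the norm of \sum_n a_n x_n from below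
    ([biorthogonal_l1_almost_isometric]); f |-> \sum_n c_n(f) x_n is a bounded
    projection onto the closed span ([biorthogonal_complemented]). Finally, the
    limit of psi(x_n) along a free ultrafilter is a continuous linear function
    of psi in the dual space. It is 1 on each tail f |-> \sum_(n >= k) c_n(f),
    whereas these tails tend to 0 at each given f: it is not the evaluation at
    a vector ([biorthogonal_nonreflexive]). *)

Set Implicit Arguments.
Unset Strict Implicit.
Unset Printing Implicit Defensive.

Import Order.TTheory GRing.Theory Num.Def Num.Theory.
Import numFieldNormedType.Exports.

Local Open Scope classical_set_scope.

(** * Biorthogonal systems spanning complemented copies of l1 *)

Section bounded_linear.
Local Open Scope ring_scope.
Context {R : realType}.

Lemma linear_le_continuous (V W : normedModType R) (f : V -> W) (M : R) :
  linear f -> (forall v, `|f v| <= M * `|v|) -> continuous f.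
Proof.
move=> lf fM.
pose fL : {linear V -> W} := HB.pack f (GRing.isLinear.Build R V W *:%R f lf).
apply: (@bounded_linear_continuous _ _ _ fL); apply/linear_boundedP.
near=> r.
move=> v; apply: (le_trans (fM v)); apply: ler_wpM2r; first by [].
by near: r; apply: nbhs_pinfty_ge; rewrite num_real.
Unshelve. all: by end_near. Qed.

Lemma cvg_norm_le (V : normedModType R) (u : nat -> V) (M : R) (cu : cvgn u) :
  (forall n, `|u n| <= M) -> `|limn u| <= M.
Proof.
move=> uM; rewrite -lim_norm//; apply: limr_le; first exact: is_cvg_norm.
exact: nearW.
Qed.

Lemma limn_lin (V : normedModType R) (a : R) (u v : nat -> V) :
  cvgn u -> cvgn v -> limn (fun n => a *: u n + v n) = a *: limn u + limn v.
Proof.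
by move=> cu cv; apply/cvg_lim => //; apply: cvgD cv; apply: cvgZ cu; exact: cvg_cst.
Qed.

End bounded_linear.

(** By compactness the values cluster at some [p]; an ultrafilter that meets every
    preimage of a neighbourhood of [p] contains it. *)
Lemma ultrafilter_bounded_cvg {R : realType} (U : set_system nat) (h : nat -> R) (M : R) :
  UltraFilter U -> (forall n, `|h n| <= M)%R -> cvg (h @ U).
Proof.
move=> UU hM; have PU : ProperFilter U := @ultra_proper _ _ UU.
have hM' : (h @ U) `[(- M)%R, M].
  by apply: (@filterE _ U) => n /=; rewrite in_itv/= -ler_norml; exact: hM.
have [p [_ pU]] := @segment_compact R (- M)%R M (h @ U) _ hM'.
apply/cvg_ex; exists p => B pB.
(* If the preimage of B is not in U, its complement is, against clustering at p. *)
have [//|UB] := in_ultra_setVsetC (h @^-1` B) UU.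
by have [q [/= qB /qB]] := pU (~` B) B UB pB.
Qed.

Section biorthogonal_l1.
Local Open Scope ring_scope.
Context {R : realType} {E : normedModType R} (e : R).
Context (x : nat -> E) (c : nat -> E -> R).
Hypothesis e01 : 0 < e < 1.
Hypothesis x_le1 : forall n, `|x n| <= 1.
Hypothesis c_lin : forall n, linear (c n : E -> R^o).
Hypothesis c_x : forall i j, c i (x j) = (i == j)%:R.
Hypothesis c_bound : forall n f, (1 - e) * \sum_(i < n) `|c i f| <= `|f|.
Hypothesis x_cvg : forall a : nat -> R, cvgn (series (fun n => `|a n|)) ->
  cvgn (series (fun n => a n *: x n)).

Let e1_gt0 : 0 < 1 - e.
Proof. by rewrite subr_gt0; case/andP: e01. Qed.

Lemma biorthD n (u v : E) : c n (u + v) = c n u + c n v.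
Proof. by have := c_lin n 1 u v; rewrite !scale1r. Qed.

Lemma biorth0 n : c n 0 = 0.
Proof.
by have := biorthD n 0 0; rewrite addr0 -[LHS]addr0 => /addrI <-.
Qed.

Lemma biorthZ n a (u : E) : c n (a *: u) = a * c n u.
Proof. by have := c_lin n a u 0; rewrite addr0 biorth0 addr0. Qed.

Lemma biorth_sum n m (a : nat -> R) :
  c n (\sum_(i < m) a i *: x i) = if (n < m)%N then a n else 0.
Proof.
elim: m => [|m IH]; first by rewrite big_ord0 biorth0.
rewrite big_ord_recr/= biorthD biorthZ IH c_x ltnS.
case: ltngtP => [nm|nm|->]; rewrite ?mulr0 ?addr0 ?add0r ?mulr1//.
Qed.

Lemma coef_norm_sum n v : \sum_(0 <= i < n) `|c i v| <= (1 - e)^-1 * `|v|.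
Proof. by rewrite ler_pdivlMl// big_mkord. Qed.

Lemma coef_cvg v : cvgn (series (fun n => `|c n v|)).
Proof.
apply: nondecreasing_is_cvgn.
  by apply/nondecreasing_seqP => n; rewrite /series/= big_nat_recr//= lerDl.
exists ((1 - e)^-1 * `|v|) => _ [n _ <-]; rewrite /series/=.
exact: coef_norm_sum.
Qed.

(** The lower bound is [c_bound] at the sum of the series, whose coefficients are
    those of [a]; it is read off on partial sums so that no continuity of the
    [c n] has to be invoked. *)
Lemma biorthogonal_l1_almost_isometric : l1_almost_isometric e x.
Proof.
move=> a ca; have cx := x_cvg ca; split=> //.
have ca_le n : series (fun n => `|a n|) n <= limn (series (fun n => `|a n|)).
  apply: nondecreasing_cvgn_le => //.
  by apply/nondecreasing_seqP => k; rewrite /series/= big_nat_recr//= lerDl.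
apply/andP; split.
  rewrite -lim_norm//; rewrite mulrC -ler_pdivlMr//.
  apply: limr_le => //; apply: nearW => n.
  rewrite ler_pdivlMr// mulrC.
  apply: limr_ge; first exact: is_cvg_norm.
  near=> m; apply: le_trans (c_bound m _).
  rewrite ler_wpM2l//; first exact: ltW.
  have nm : (n <= m)%N by near: m; exact: nbhs_infty_ge.
  rewrite /series/= !big_mkord.
  under [leRHS]eq_bigr => i _ do rewrite biorth_sum ltn_ord.
  rewrite -(big_mkord xpredT (fun i => `|a i|)) -(big_mkord xpredT (fun i => `|a i|)).
  by rewrite (big_cat_nat (leq0n n) nm)//= lerDl sumr_ge0.
apply: (cvg_norm_le cx) => n; rewrite (le_trans _ (ca_le n))//.
rewrite /series/= (le_trans (ler_norm_sum _ _ _))// ler_sum// => i _.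
by rewrite normrZ ler_piMr.
Unshelve. all: by end_near. Qed.

Definition coef_proj (v : E) : E := limn (series (fun n => c n v *: x n)).

Lemma coef_proj_cvg v : cvgn (series (fun n => c n v *: x n)).
Proof. exact/x_cvg/coef_cvg. Qed.

Lemma coef_proj_linear : linear coef_proj.
Proof.
move=> a u v; rewrite /coef_proj -limn_lin; try exact: coef_proj_cvg.
congr (limn _); apply/funext => n; rewrite /series/= scaler_sumr -big_split/=.
by apply: eq_bigr => i _; rewrite biorthD biorthZ scalerDl scalerA.
Qed.

Lemma coef_proj_le v : `|coef_proj v| <= (1 - e)^-1 * `|v|.
Proof.
apply: (cvg_norm_le (@coef_proj_cvg v)) => n.
rewrite (le_trans _ (coef_norm_sum n v))// (le_trans (ler_norm_sum _ _ _))//.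
by rewrite ler_sum// => i _; rewrite normrZ ler_piMr.
Qed.

Lemma coef_proj_continuous : continuous coef_proj.
Proof. exact: linear_le_continuous coef_proj_linear coef_proj_le. Qed.

Lemma coef_proj_span v : lin_span x v -> coef_proj v = v.
Proof.
move=> [n [a ->]]; apply/cvg_lim => //; apply: cvg_near_cst.
near=> m; have nm : (n <= m)%N by near: m; exact: nbhs_infty_ge.
(* Beyond rank n the coefficients of v vanish and the series is stationary. *)
rewrite /series/= (big_cat_nat (leq0n n) nm)//= [X in _ + X]big1_seq ?addr0.
  by rewrite big_mkord; apply: eq_bigr => i _; rewrite biorth_sum ltn_ord.
move=> i /andP[_]; rewrite mem_index_iota => /andP[ni _].
by rewrite biorth_sum ltnNge ni/= scale0r.
Unshelve. all: by end_near. Qed.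

Lemma biorthogonal_complemented : complemented (closure (lin_span x)).
Proof.
pose PL : {linear E -> E} :=
  HB.pack coef_proj (GRing.isLinear.Build R E E *:%R coef_proj coef_proj_linear).
exists PL; split=> [|v|v Fv].
- exact: coef_proj_continuous.
- apply: (@closed_cvg _ _ \oo _ (series (fun n => c n v *: x n)) (closure (lin_span x))).
  + exact: closed_closure.
  + apply: nearW => n; apply: subset_closure; exists n, (fun i => c i v).
    by rewrite /series/= big_mkord.
  + exact: coef_proj_cvg.
(* The fixed points of a continuous map form a closed set. *)
- have : closed [set v | coef_proj v = v].
    have -> : [set v | coef_proj v = v] = (fun v => coef_proj v - v) @^-1` [set 0].
      by apply/seteqP; split=> w /=; [move=> ->; rewrite subrr|move=> /subr0_eq].
    apply: preimage_closed; last first.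
      exact: (accessible_closed_set1 (hausdorff_accessible (@norm_hausdorff _ _))).
    by move=> w _; apply: cvgB; [exact: coef_proj_continuous|exact: cvg_id].
  by move=> /(_ v); apply; apply: closureS Fv => w; exact: coef_proj_span.
Qed.

Let coef_series_cvg v : cvgn (series (c ^~ v)).
Proof. exact/(@normed_cvg R R^o)/coef_cvg. Qed.

(** The tail \sum_(i >= k) c_i(v), written as a difference so that its convergence
    to 0 in [k] is immediate. *)
Definition coef_tail k (v : E) : R := limn (series (c ^~ v)) - series (c ^~ v) k.

Lemma coef_tail_cvg0 v : coef_tail ^~ v @ \oo --> 0.
Proof.
rewrite -[X in _ --> X](subrr (limn (series (c ^~ v)))).
by apply: (@cvgB R R^o); [exact: cvg_cst|exact: coef_series_cvg].
Qed.

Lemma coef_tail_linear k : linear (coef_tail k : E -> R^o).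
Proof.
move=> a u v; rewrite /coef_tail.
have cE n : series (c ^~ (a *: u + v)) n = a * series (c ^~ u) n + series (c ^~ v) n.
  rewrite /series/= mulr_sumr -big_split; apply: eq_bigr => i _/=.
  by rewrite biorthD biorthZ.
have -> : series (c ^~ (a *: u + v)) =
    (fun n => a *: (series (c ^~ u) n : R^o) + series (c ^~ v) n).
  exact/funext.
rewrite (@limn_lin R R^o)// scalerBr opprD addrACA; congr (_ + _).
Qed.

Lemma coef_tail_le k v : `|coef_tail k v| <= 2 * (1 - e)^-1 * `|v|.
Proof.
have le n : `|series (c ^~ v) n| <= (1 - e)^-1 * `|v|.
  by apply: le_trans (coef_norm_sum n v); exact: ler_norm_sum.
rewrite -mulrA mulr_natl mulr2n (le_trans (ler_normB _ _))// lerD ?le//.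
exact: (@cvg_norm_le R R^o _ _ (@coef_series_cvg v)).
Qed.

Lemma coef_tail_x k n : (k <= n)%N -> coef_tail k (x n) = 1.
Proof.
move=> kn; rewrite /coef_tail [X in _ - X]big1_seq ?subr0; last first.
  move=> i /andP[_]; rewrite mem_index_iota => /andP[_ ik].
  by rewrite c_x ltn_eqF// (leq_trans ik).
apply/cvg_lim => //; apply: cvg_near_cst; near=> m.
have nm : (n < m)%N by near: m; exact: nbhs_infty_gt.
rewrite /series/= (bigD1_seq n) ?mem_index_iota ?iota_uniq//=.
rewrite c_x eqxx big1 ?addr0// => i /negbTE.
by rewrite c_x => ->.
Unshelve. all: by end_near. Qed.

(** The functional psi |-> lim psi(x_n) along a free ultrafilter takes the value 1 at
    all the tails [coef_tail k]. Were it the evaluation at [v], the tails would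
    all be 1 at [v], but they converge to 0 there. *)
Lemma biorthogonal_nonreflexive : ~ reflexive_space E.
Proof.
move=> refl.
have [U [UU ooU]] := @ultraFilterLemma nat (nbhs \oo) _.
have PU := @ultra_proper _ _ UU.
(* Membership in the bidual only requires |psi (x n)| <= |psi|, as |x n| <= 1. *)
pose L (psi : dual_space E) : R := lim (psi (x n) @[n --> U]).
have psi_le (psi : dual_space E) n : `|psi (x n)| <= `|psi| by exact: dual_norm_ub.
have L_cvg (psi : dual_space E) : cvg (psi (x n) @[n --> U]).
  exact: ultrafilter_bounded_cvg (psi_le psi).
have L_lin : linear (L : dual_space E -> R^o).
  move=> a f g; apply/cvg_lim => //.
  have -> : (fun n => dual_fun (a *: f + g) (x n)) =
      (fun n => a * dual_fun f (x n) + dual_fun g (x n)).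
    by apply/funext => n; rewrite /dual_fun linearP.
  by apply: cvgD (L_cvg g); apply: cvgMl_tmp; exact: L_cvg.
have L_le psi : `|L psi| <= 1 * `|psi|.
  rewrite mul1r /L -lim_norm//; apply: limr_le; first exact: is_cvg_norm.
  by apply: filterE => n; exact: psi_le.
have L_dual : (L : dual_space E -> R^o) \in dual_pred (E := dual_space E).
  by apply/mem_set; split => //; exact: linear_le_continuous L_lin L_le.
have tail_dual k : (coef_tail k : E -> R^o) \in dual_pred (E := E).
  apply/mem_set; split; first exact: coef_tail_linear.
  exact: linear_le_continuous (coef_tail_linear k) (coef_tail_le k).
pose tail k : dual_space E := exist _ (coef_tail k : E -> R^o) (tail_dual k).
have [v Lv] := refl (exist _ (L : dual_space E -> R^o) L_dual).
have tail1 k : coef_tail k v = 1.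
  rewrite -[LHS](Lv (tail k)); apply/cvg_lim => //.
  apply: cvg_near_cst; apply: ooU; near=> n; apply: coef_tail_x.
  by near: n; exact: nbhs_infty_ge.
have : (1 : R) = 0.
  apply: (cvg_unique _ _ (coef_tail_cvg0 v)) => //.
  by rewrite (funext tail1); exact: cvg_cst.
by move/eqP; rewrite oner_eq0.
Unshelve. all: by end_near. Qed.

End biorthogonal_l1.

(** * The kernel of a Hardy operator *)

Section L0_facts.
Local Open Scope ring_scope.
Context {R : realType} (I : domain).

Definition L0_of (u : R -> R) (mu : measurable_fun [set: measurableTypeR R] u) : @L0 R I :=
  toL0 I (@mfun_Sub _ _ (measurableTypeR R) R u (mem_set mu)).

Lemma L0_ofE u mu : \forall t \ae lebesgue_on I, @L0_of u mu t = u t.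
Proof. exact: toL0K. Qed.

Lemma nsub_norm_ge0 (X : @normedSubspace R I) (f : L0 I) : nsub_set X f -> 0 <= nsub_norm X f.
Proof.
by move=> Xf; have := normr_ge0 (Sub f (mem_set Xf) : space_of X).
Qed.

Lemma nsubZ (X : @normedSubspace R I) a (f : L0 I) : nsub_set X f -> nsub_set X (a *: f).
Proof. by move=> Xf; rewrite -[_ *: _]addr0; apply: nsubP => //; exact: nsub0. Qed.

(** Otherwise each step decreases [phi] by more than [e * m], which the lower bound
    [m] allows only finitely often. *)
Lemma slow_decrease (phi : nat -> R) (e m : R) : 0 < e -> 0 < m ->
  (forall n, m <= phi n) -> exists n, (1 - e) * phi n <= phi n.+1.
Proof.
move=> e0 m0 mphi; apply: contrapT => /forallNP lt.
have le n : phi n <= phi 0%N - n%:R * (e * m).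
  elim: n => [|n IH]; first by rewrite mul0r subr0.
  have /negP := lt n; rewrite -ltNge => /ltW phiS; apply: (le_trans phiS).
  rewrite mulrBl mul1r -natr1 mulrDl mul1r opprD addrA lerB//.
  by rewrite ler_wpM2l// ltW.
have em0 : 0 < e * m by rewrite mulr_gt0.
have phi0 : 0 <= phi 0%N / (e * m).
  by rewrite divr_ge0// ?ltW// (lt_le_trans m0).
have := le_trans (mphi (Num.bound (phi 0%N / (e * m)))) (le _).
apply/negP; rewrite -ltNge (lt_trans _ m0)// subr_lt0 -ltr_pdivrMr//.
exact: archi_boundP.
Qed.

End L0_facts.

Section kernel.
Local Open Scope ring_scope.
Context {R : realType} (I : domain) (T : hardy_op).
Notation mu := (@lebesgue_measure R).

(** Read [hdom I T x t] as: a mass placed at [t] is felt at [x]. This relation is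
    the order of the line or its reverse, which lets both operators be treated
    at once. *)
Lemma hdom_trans (x t u : R) : hdom I T x t -> hdom I T t u -> hdom I T x u.
Proof.
rewrite /hdom; case: T => /=; rewrite !in_itv/= ?andbT.
  by move=> /andP[_ tx] /andP[-> ut]; rewrite (le_trans ut).
by move=> [_ xt] [Iu tu]; split=> //; rewrite (le_trans xt).
Qed.

Definition kset (c : R) : set R :=
  if T is Cesaro then `[c, +oo[%classic else `]-oo, c]%classic.

Lemma measurable_kset c : measurable (kset c : set (measurableTypeR R)).
Proof. by rewrite /kset; case: T; exact: measurable_itv. Qed.

Lemma ksetE c x : dom I c -> kset c x <-> hdom I T x c.
Proof.
move=> Ic; have c0 := dom_ge0 Ic; rewrite /kset /hdom; case: T => /=;
  rewrite !in_itv/= ?c0 ?andbT//.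
by split=> [?|[]].
Qed.

(** The response at [x] to a unit of weighted mass at [c]. The power
    function agrees with the inverse in [hcoef] for nonnegative [x] and makes
    the measurability on the whole line plain. *)
Definition kfun (c x : R) : R :=
  (if T is Cesaro then x `^ (-1) else 1) * \1_(kset c) x.

Lemma measurable_kfun c : measurable_fun [set: measurableTypeR R] (kfun c).
Proof.
apply: measurable_funM; last exact: (measurable_indic (measurable_kset c)).
by case: T; [exact: measurable_powR|exact: measurable_cst].
Qed.

Definition kern (c : R) : @L0 R I := L0_of I (measurable_kfun c).

Lemma kernE (c : R) : dom I c -> \forall x \ae lebesgue_on I, [/\ dom I x,
  hdom I T x c -> kern c x = hcoef T x & ~ hdom I T x c -> kern c x = 0].
Proof.
move=> Ic; have := L0_ofE I (measurable_kfun c); have := @ae_dom_W R I.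
apply: filterS2 => x Ix xE; have x0 := dom_ge0 Ix; rewrite /kern xE /kfun.
split=> // [/(ksetE x Ic) xc|xc]; rewrite -hcoef_powR// indicE.
  by rewrite mem_set// mulr1.
by rewrite memNset ?mulr0// => /(ksetE x Ic).
Qed.

Lemma kern_ge0 (c : R) : dom I c -> \forall x \ae lebesgue_on I, 0 <= kern c x.
Proof.
move=> Ic; apply: filterS (kernE Ic) => x [Ix xc xNc].
have [/xc ->|/xNc ->//] := pselect (hdom I T x c).
exact/hcoef_ge0/(dom_ge0 Ix).
Qed.

Lemma kern_le (c d : R) : dom I c -> hdom I T c d ->
  \forall x \ae lebesgue_on I, `|kern c x| <= `|kern d x|.
Proof.
move=> Ic cd; have Id := hdom_dom Ic cd.
move: (kernE Ic) (kernE Id); apply: filterS2 => x [Ix xc xNc] [_ xd xNd].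
have [xIc|/xNc ->] := pselect (hdom I T x c); last by rewrite normr0.
by rewrite xc// xd//; exact: hdom_trans cd.
Qed.

(** The norm of [f] in the weighted L1 space over [B]. *)
Definition wmass (f : R -> R) (B : set R) : \bar R :=
  (\int[mu]_(t in B) (hwt T t * `|f t|)%:E)%E.

Lemma wmass_hint_ge0 (x : R) B (f : L0 I) t : B `<=` hdom I T x -> B t ->
  (0 <= (hwt T t * `|f t|)%:E)%E.
Proof. by move=> Bx /Bx; exact: hint_ge0. Qed.

Lemma wmass_ge0 (x : R) B (f : L0 I) : B `<=` hdom I T x -> (0 <= wmass f B)%E.
Proof.
move=> Bx; apply: integral_ge0 => t Bt; exact: (wmass_hint_ge0 f Bx Bt).
Qed.

Lemma measurable_wint (x : R) B (f : L0 I) : B `<=` hdom I T x ->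
  measurable_fun B (fun t => (hwt T t * `|f t|)%:E).
Proof.
move=> Bx; apply: measurable_funS Bx _; first exact: measurable_hdom.
exact: measurable_hint.
Qed.

(** Wherever [c] is felt, all of [B] is felt, so that T|f| collects at least the mass
    over [B]. *)
Lemma Tabs_ge_kern (c : R) (B : set R) (f : L0 I) : dom I c ->
  measurable (B : set (measurableTypeR R)) -> B `<=` hdom I T c ->
  \forall x \ae lebesgue_on I, ((kern c x)%:E * wmass f B <= Tabs T f x)%E.
Proof.
move=> Ic mB Bc; apply: filterS (kernE Ic) => x [Ix xc xNc].
have [xIc|/xNc ->] := pselect (hdom I T x c); last first.
  by rewrite mul0e Tabs_ge0.
rewrite xc// TabsE lee_wpmul2l ?lee_fin ?hcoef_ge0 ?(dom_ge0 Ix)//.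
apply: ge0_subset_integral => //; first exact: measurable_hdom.
- exact: measurable_hint.
- by move=> t; exact: hint_ge0.
- by move=> t /Bc; exact: hdom_trans xIc.
Qed.

(** Only the mass over [B] counts, and where any of it is felt, [c] is felt too. The
    inclusion in [hdom I T c0] makes the weight measurable and nonnegative on [B]. *)
Lemma Tabs_le_kern (c0 c : R) (B : set R) (f : L0 I) : dom I c0 -> dom I c ->
  measurable (B : set (measurableTypeR R)) ->
  B `<=` hdom I T c0 ->
  (forall t, B t -> hdom I T t c) ->
  (\forall t \ae lebesgue_on I, ~ B t -> f t = 0) ->
  \forall x \ae lebesgue_on I, (Tabs T f x <= (kern c x)%:E * wmass f B)%E.
Proof.
move=> Ic0 Ic mB Bc0 Bc /ae_dom fB; apply: filterS (kernE Ic) => x [Ix xc xNc].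
pose h t := (hwt T t * `|f t|)%:E.
have -> : Tabs T f x = ((hcoef T x)%:E * \int[mu]_(t in hdom I T x `&` B) h t)%E.
  rewrite TabsE integral_mkcondr; congr (_ * _)%E; apply: ae_eq_integral.
  - exact: measurable_hdom.
  - exact: measurable_hint.
  - apply/(measurable_restrict _ mB); first exact: measurable_hdom.
    apply: (@measurable_wint x); exact: subIsetl.
  - apply: filterS fB => t ft xt; rewrite /patch; case: ifPn => // /negP tB.
    rewrite ft ?normr0 ?mulr0//; first exact: hdom_dom xt.
    by move=> Bt; apply: tB; exact/mem_set.
have [xIc|xIc] := pselect (hdom I T x c).
  rewrite xc// lee_wpmul2l ?lee_fin ?hcoef_ge0 ?(dom_ge0 Ix)//.
  apply: ge0_subset_integral => //.
  - exact: measurableI (measurable_hdom _ _ _) mB.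
  - exact: measurable_wint Bc0.
  - by move=> t; exact: wmass_hint_ge0 Bc0.
rewrite xNc// mul0e (_ : _ `&` B = set0) ?integral_set0 ?mule0//.
by apply/seteqP; split => // t [xt /Bc tc]; apply: xIc; exact: hdom_trans tc.
Qed.

End kernel.

(** * Norms of functions living on a short window *)

Section Tspace_bounds.
Local Open Scope ring_scope.
Context {R : realType} (I : domain) (T : hardy_op) (X : banachFunctionSpace R I).
Notation mu := (@lebesgue_measure R).
Notation kern := (@kern R I T).

Lemma kern_scaled_le (c r : R) (g : L0 I) : dom I c -> 0 < r -> nsub_set X g ->
  (\forall x \ae lebesgue_on I, kern c x * r <= g x) ->
  nsub_set X (kern c) /\ r * nsub_norm X (kern c) <= nsub_norm X g.
Proof.
move=> Ic r0 Xg kg; have [|Xrk le] := @bfs_ideal R I X (r *: kern c) g _ Xg.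
  move: kg (kern_ge0 T Ic) (L0ZE r (kern c)).
  apply: filterS3 => x kg k0 ->; rewrite normrM (gtr0_norm r0) (ger0_norm k0).
  by rewrite mulrC (le_trans kg)// ler_norm.
have Xk : nsub_set X (kern c).
  by rewrite -[kern c](scalerK (lt0r_neq0 r0)); exact: nsubZ.
by split=> //; rewrite -[r in r * _](gtr0_norm r0) -nsub_normZ.
Qed.

Lemma kern_norm_le (c d : R) : dom I c -> hdom I T c d -> nsub_set X (kern d) ->
  nsub_set X (kern c) /\ nsub_norm X (kern c) <= nsub_norm X (kern d).
Proof. by move=> Ic cd; apply: bfs_ideal; exact: kern_le. Qed.

(** Where [c] is felt, T|f| is at least [hcoef] times the mass of [f] over [hdom a],
    which is positive since T|f| does not vanish at [a]. The ideal property does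
    the rest. *)
Lemma kern_mem (f : L0 I) (a c : R) : dom I a -> dom I c -> hdom I T c a ->
  Tset T X f -> Tabs T f a != 0%E -> nsub_set X (kern c).
Proof.
move=> Ia Ic ca [g fg Xg] fa.
have w_gt0 : (0 < wmass T f (hdom I T a))%E.
  rewrite lt_neqAle (@wmass_ge0 R I T a _ f (@subset_refl _ _)) andbT eq_sym.
  by apply: contra_neq fa => w0; rewrite TabsE -/(wmass T f (hdom I T a)) w0 mule0.
(* The mass may be infinite; any positive real below it will do. *)
have [r r0 rw] : exists2 r : R, 0 < r & (r%:E <= wmass T f (hdom I T a))%E.
  case: (wmass _ _ _) w_gt0 => [r| |]//; first by exists r.
  by exists 1; rewrite ?leey.
have ac : hdom I T a `<=` hdom I T c by move=> t; exact: hdom_trans ca.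
have [|//] := @kern_scaled_le c r g Ic r0 Xg.
move: (Tabs_ge_kern f Ic (measurable_hdom I T a) ac) fg (kern_ge0 T Ic).
apply: filterS3 => x kf fg k0; rewrite -lee_fin -fg (le_trans _ kf)//.
by rewrite EFinM lee_wpmul2l.
Qed.

(** An infinite mass over [B] would make T|f| infinite wherever [kern c] is positive,
    forcing [kern c] = 0 a.e. *)
Lemma Tnorm_ge_wmass (c : R) (B : set R) (f : L0 I) : dom I c -> nsub_set X (kern c) ->
  0 < nsub_norm X (kern c) -> measurable (B : set (measurableTypeR R)) ->
  B `<=` hdom I T c -> Tset T X f ->
  wmass T f B \is a fin_num /\
  nsub_norm X (kern c) * fine (wmass T f B) <= Tnorm T X f.
Proof.
move=> Ic Xk k0 mB Bc [g fg Xg]; have w0 := wmass_ge0 f Bc.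
have kf := @Tabs_ge_kern R I T c B f Ic mB Bc.
have wfin : wmass T f B \is a fin_num.
  rewrite ge0_fin_numE// ltey; apply/negP => /eqP woo.
  suff k00 : kern c = 0.
    by move: k0; rewrite k00 -(scale0r (0 : L0 I)) nsub_normZ ?normr0 ?mul0r ?ltxx//; exact: nsub0.
  apply/L0P; move: kf fg (kern_ge0 T Ic) (@L00E R I).
  rewrite /is_absT; apply: filterS4 => x kf fg k0' -> _.
  move: kf; rewrite fg woo; case: (ltgtP (kern c x) 0) k0' => // kx _.
  by rewrite gt0_muley ?lte_fin// leye_eq.
split=> //; rewrite /Tnorm (absTE fg) mulrC.
have := w0; rewrite -(fineK wfin) lee_fin le_eqVlt => /predU1P[<-|r0].
  by rewrite mul0r nsub_norm_ge0.
have [|//] := @kern_scaled_le c (fine (wmass T f B)) g Ic r0 Xg.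
move: kf fg; apply: filterS2 => x kf fg.
by rewrite -lee_fin EFinM fineK// -fg.
Qed.

Lemma Tnorm_le_wmass (c0 c r : R) (B : set R) (f : L0 I) : dom I c0 -> dom I c ->
  nsub_set X (kern c) ->
  measurable (B : set (measurableTypeR R)) ->
  B `<=` hdom I T c0 -> (forall t, B t -> hdom I T t c) ->
  (\forall t \ae lebesgue_on I, ~ B t -> f t = 0) ->
  wmass T f B = r%:E ->
  Tset T X f /\ Tnorm T X f <= r * nsub_norm X (kern c).
Proof.
move=> Ic0 Ic Xk mB Bc0 Bc fB wr.
have r0 : 0 <= r by rewrite -lee_fin -wr (wmass_ge0 f Bc0).
have Xrk := nsubZ r Xk.
have [|h [fh Xh hle]] := @is_absT_dom R I T X f _ Xrk.
  have := Tabs_le_kern Ic0 Ic mB Bc0 Bc fB.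
  have := L0ZE r (kern c); apply: filterS2 => x -> fk.
  by rewrite (le_trans fk)// wr -EFinM mulrC.
split; first by exists h.
by rewrite /Tnorm (absTE fh) (le_trans hle)// nsub_normZ// ger0_norm.
Qed.

Lemma hdom_between (a b t : R) : dom I a -> dom I b -> hdom I T b a ->
  minr a b <= t <= maxr a b -> [/\ dom I t, hdom I T t a & hdom I T b t].
Proof.
move=> Ia Ib ba /andP[mt tM].
have It : dom I t.
  move: Ia Ib; rewrite /dom; case: I => /=; rewrite !in_itv/= ?andbT.
    move=> /andP[a0 a1] /andP[b0 b1]; rewrite (le_trans _ mt)/=; last by rewrite le_min a0 b0.
    by rewrite (le_trans tM)// ge_max a1 b1.
  by move=> a0 b0; rewrite (le_trans _ mt)// le_min a0 b0.
have a0 := dom_ge0 Ia; have t0 := dom_ge0 It.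
move: ba mt tM; rewrite /hdom; case: T => /=; rewrite !in_itv/= ?andbT.
  by move=> /andP[_ ab]; rewrite min_l// max_r// => at_ tb; rewrite a0 at_ t0 tb.
by move=> [_ ba]; rewrite min_r// max_l// => bt ta; split.
Qed.

(** In both cases one can move away from [a] in the direction in which less is felt
    and still leave an interval on which the effect of [b] is visible; this is
    where the endpoints must be avoided. *)
Lemma hdom_further (a : R) : dom I a -> a != 0 -> a != 1 ->
  exists b u v : R, [/\ 0 < b, dom I b, b != a, hdom I T b a & u < v /\
    forall x, u < x < v -> [/\ dom I x, 0 < x & hdom I T x b]].
Proof.
move=> Ia an0 an1; have a_ge0 := dom_ge0 Ia.
have a0 : 0 < a by rewrite lt_neqAle eq_sym an0.
move: Ia; rewrite /dom /hdom; case: T; last first.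
  move=> Ia; have hI x : 0 < x < a -> [set` itv_of I] x.
    move: Ia; case: I => /=; rewrite !in_itv/= ?andbT.
      by move=> /andP[_ a1] /andP[x0 xa]; rewrite (ltW x0) (le_trans (ltW xa)).
    by move=> _ /andP[/ltW].
  have ha : a / 2 < a by lra.
  exists (a / 2), 0, (a / 2); split.
  - by rewrite divr_gt0.
  - by apply: hI; rewrite divr_gt0.
  - by rewrite lt_eqF.
  - by split=> //=; rewrite in_itv/= andbT ltW.
  - split=> [|x /andP[x0 xa]]; first by rewrite divr_gt0.
    split=> //; first by apply: hI; rewrite x0 (lt_trans xa).
    split; first by apply: hI; rewrite divr_gt0.
    by rewrite /= in_itv/= andbT ltW.
case: I => /=; rewrite !in_itv/= ?andbT.
  move=> /andP[_ a_le1]; have a1 : a < 1 by rewrite lt_neqAle an1.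
  have ab : a < (a + 1) / 2 by lra.
  exists ((a + 1) / 2), ((a + 1) / 2), 1.
  split; rewrite ?in_itv/= ?gt_eqF//; [lra|lra|lra|split=> [|x /andP[bx x1]]; first by lra].
  by split; rewrite ?in_itv/=; lra.
move=> _; have ab : a < a + 1 by lra.
exists (a + 1), (a + 1), (a + 2).
split; rewrite ?in_itv/= ?andbT ?gt_eqF//; [lra|lra|lra|split=> [|x /andP[bx x1]]; first by lra].
by split; rewrite ?in_itv/= ?andbT; lra.
Qed.

(** The points [c n] move monotonically from [a] towards [b], and the norms of their
    kernels decrease but stay above that of [kern b], which is positive.
    [slow_decrease] then yields two consecutive points with almost equal
    norms. *)
Lemma exists_window (e : R) (f : L0 I) : 0 < e -> Tset T X f -> f <> 0 ->
  exists p q c0 c1 : R,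
    [/\ 0 < p < q, dom I c0, dom I c1 &
      forall t, p < t < q -> hdom I T c0 t /\ hdom I T t c1] /\
    [/\ nsub_set X (kern c0), nsub_set X (kern c1), 0 < nsub_norm X (kern c0) &
      (1 - e) * nsub_norm X (kern c1) <= nsub_norm X (kern c0)].
Proof.
move=> e0 Tf fn0.
have [a [Ia an0 an1 fa]] : exists a : R, [/\ dom I a, a != 0, a != 1 & Tabs T f a != 0%E].
  apply: contrapT => nex; apply: fn0; apply: (@Tabs_eq0 R I T); apply/ae_dom.
  have ne (r : R) : \forall t \ae @lebesgue_measure R, t != r.
    exists [set r]; split => //; first exact: lebesgue_measure_set1.
    by move=> t /= /negP; rewrite negbK => /eqP.
  move: (ne 0) (ne 1); apply: (@filterS2 _ _ (ae_filter_ringOfSetsType mu)) => t t0 t1 It.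
  by apply: contrapT => /eqP ft; apply: nex; exists t.
have [b [u [v [b0 Ib ba hba [uv xuv]]]]] := hdom_further Ia an0 an1.
(* This sequence starts at a and tends to b without reaching it, on either side. *)
pose c (n : nat) : R := b + (a - b) * n.+1%:R^-1.
have c_between n : minr a b <= c n <= maxr a b.
  have n0 : 0 < n.+1%:R^-1 :> R by rewrite invr_gt0.
  have n1 := @invS_le1 R n.
  rewrite /c; move: (n.+1%:R^-1) n0 n1 => s s0 s1.
  by case: (leP a b) => ab; rewrite ?(min_l, max_r, min_r, max_l) ?(ltW ab)//; nra.
have [Ic hca hbc] : [/\ forall n, dom I (c n), forall n, hdom I T (c n) a &
    forall n, hdom I T b (c n)].
  by split=> n; have [] := hdom_between Ia Ib hba (c_between n).
have ccS n : hdom I T (c n.+1) (c n).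
  have [//|_ _ //] := @hdom_between a (c n.+1) (c n) Ia (Ic n.+1) (hca n.+1).
  have n1 := @invS_le1 R n.
  have nS : n.+2%:R^-1 <= n.+1%:R^-1 :> R by rewrite lef_pV2 ?posrE// ler_nat.
  rewrite ge_min le_max /c; move: (n.+1%:R^-1) (n.+2%:R^-1) n1 nS => s s' s1 ss'.
  by case: (leP a b) => ab; apply/andP; split; apply/orP; [left|right|right|left]; nra.
have c0 n : 0 < c n.
  have /andP[+ _] := c_between n; apply: lt_le_trans; rewrite lt_min b0 andbT.
  by rewrite lt_neqAle eq_sym an0 (dom_ge0 Ia).
have cS n : c n.+1 != c n.
  rewrite /c (inj_eq (addrI _)) (inj_eq (mulfI _)) ?subr_eq0 1?eq_sym//.
  by rewrite (inj_eq invr_inj) eqr_nat eqSS ltn_eqF.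
have Xc n : nsub_set X (kern (c n)) by exact: kern_mem Ia (Ic n) (hca n) Tf fa.
have Xb : nsub_set X (kern b) by exact: kern_mem Ia Ib hba Tf fa.
have b_gt0 : 0 < nsub_norm X (kern b).
  rewrite lt_neqAle nsub_norm_ge0// andbT eq_sym; apply/eqP => /(nsub_norm0 Xb) kb0.
  have : \forall x \ae lebesgue_on I, hdom I T x b -> hcoef T x = 0.
    move: (kernE T Ib) (@L00E R I).
    by apply: filterS2 => x [_ xb _]; rewrite -kb0 => kx /xb <-.
  move=> /ae_dom /ae_pick /(_ uv)[x [/xuv[Ix x0 xb] /(_ Ix xb) hx0]].
  by have := hcoef_gt0 T x0; rewrite hx0 ltxx.
have [n nP] : exists n, (1 - e) * nsub_norm X (kern (c n)) <= nsub_norm X (kern (c n.+1)).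
  apply: (slow_decrease e0 b_gt0) => n.
  by have [] := kern_norm_le Ib (hbc n) (Xc n).
(* The order of the two points depends on the operator. *)
exists (minr (c n.+1) (c n)), (maxr (c n.+1) (c n)), (c n.+1), (c n); split.
  split=> //.
    by rewrite lt_min !c0/=; case: (ltgtP (c n.+1) (c n)) (cS n).
  move=> t /andP[mt tM].
  have [|_ ? ?] := @hdom_between (c n) (c n.+1) t (Ic n) (Ic n.+1) (ccS n) => //.
  by rewrite minC maxC !ltW.
split=> //; apply: (lt_le_trans b_gt0).
by have [] := kern_norm_le Ib (hbc n.+1) (Xc n.+1).
Qed.
End Tspace_bounds.

(** * Step functions over disjoint sets *)

Section step_functions.
Local Open Scope ring_scope.
Context {R : realType} (I : domain) (T : hardy_op) (J : nat -> set R).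
Notation mu := (@lebesgue_measure R).
Hypothesis mJ : forall n, measurable (J n : set (measurableTypeR R)).
Hypothesis tJ : trivIset setT J.
Hypothesis J0 : forall n, (0 < mu (J n) < +oo)%E.
Hypothesis Jdom : forall n, J n `<=` dom I.
Hypothesis Jpos : forall n t, J n t -> 0 < t.

Let len n := fine (mu (J n)).

Let len_gt0 n : 0 < len n.
Proof. by rewrite fine_gt0. Qed.

Let lenE n : mu (J n) = (len n)%:E.
Proof. by rewrite fineK// gt0_fin_numE; have /andP[] := J0 n. Qed.

(** The function equal to [a k / len k] on [J k]: its integral over [J k] is [a k].
    Written as a pointwise limit, it is measurable and linear in [a] at once. *)
Definition step (a : nat -> R) (t : R) : R :=
  limn (series (fun i => a i * (len i)^-1 * \1_(J i) t)).

Let step_term a k i t : J k t -> i != k -> a i * (len i)^-1 * \1_(J i) t = 0 :> R.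
Proof.
move=> Jt ik; rewrite indicE memNset ?mulr0// => Jit; move/eqP: ik; apply.
by apply: tJ => //; exists t.
Qed.

Lemma step_cvg a k t : J k t ->
  series (fun i => a i * (len i)^-1 * \1_(J i) t) @ \oo --> a k / len k.
Proof.
move=> Jt; apply: cvg_near_cst; near=> n.
have kn : (k < n)%N by near: n; exact: nbhs_infty_gt.
rewrite /series/= (bigD1_seq k) ?mem_index_iota ?iota_uniq//=.
rewrite big1 => [|i ik]; last exact: step_term ik.
by rewrite addr0 indicE mem_set// mulr1.
Unshelve. all: by end_near. Qed.

Lemma step_cvg0 a t : ~ (\bigcup_n J n) t ->
  series (fun i => a i * (len i)^-1 * \1_(J i) t) @ \oo --> (0 : R).
Proof.
move=> nJt; apply: cvg_near_cst; apply: nearW => n.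
rewrite /series/= big1// => i _; rewrite indicE memNset ?mulr0// => Jit.
by apply: nJt; exists i.
Qed.

Lemma stepE a k t : J k t -> step a t = a k / len k.
Proof. by move=> Jt; apply/cvg_lim => //; exact: step_cvg. Qed.

Lemma stepE0 a t : ~ (\bigcup_n J n) t -> step a t = 0.
Proof. by move=> Jt; apply/cvg_lim => //; exact: step_cvg0. Qed.

Lemma measurable_step a : measurable_fun [set: measurableTypeR R] (step a).
Proof.
apply: (@measurable_fun_cvg _ (measurableTypeR R) R setT
  (fun n t => series (fun i => a i * (len i)^-1 * \1_(J i) t) n)).
  move=> n; apply: measurable_sum => i.
  by apply: measurable_funM => //; exact: measurable_indic.
move=> t _; have [[k _ Jt]|Jt] := pselect ((\bigcup_n J n) t).
  by rewrite (stepE a Jt); exact: step_cvg.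
by rewrite (stepE0 a Jt); exact: step_cvg0.
Qed.

(** The inverse of [hwt] on the positive half-line, in a form that is visibly
    measurable. *)
Definition hwti (t : R) : R := if T is Cesaro then 1 else t.

Lemma hwtK t : 0 < t -> hwt T t * hwti t = 1.
Proof.
by move=> t0; rewrite /hwt /hwti; case: T; rewrite ?mulr1// mulVf// gt_eqF.
Qed.

Lemma measurable_wstep a :
  measurable_fun [set: measurableTypeR R] (fun t => hwti t * step a t).
Proof.
apply: measurable_funM; last exact: measurable_step.
by rewrite /hwti; case: T; [exact: measurable_cst|exact: measurable_id].
Qed.

(** Dividing by the weight makes the coefficients independent of the position: the
    weighted mass of [wstep a] over [J k] is [a k]. *)
Definition wstep (a : nat -> R) : @L0 R I := L0_of I (measurable_wstep a).

Lemma wstepE a k : \forall t \ae mu, J k t -> hwt T t * wstep a t = a k / len k.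
Proof.
have /ae_dom := L0_ofE I (measurable_wstep a); apply: filterS => t at_ Jt.
by rewrite at_; [rewrite mulrA hwtK ?mul1r ?(stepE a Jt)//; exact: Jpos Jt|exact: Jdom Jt].
Qed.

Lemma wstepE0 a : \forall t \ae lebesgue_on I, ~ (\bigcup_n J n) t -> wstep a t = 0.
Proof.
move: (L0_ofE I (measurable_wstep a)); apply: filterS => t at_ Jt.
by rewrite /wstep at_ stepE0// mulr0.
Qed.

Lemma wstep_lin r a b : wstep (fun i => r * a i + b i) = r *: wstep a + wstep b.
Proof.
apply/L0P.
have := L0DE (r *: wstep a) (wstep b); have := L0ZE r (wstep a).
have := L0_ofE I (measurable_wstep a); have := L0_ofE I (measurable_wstep b).
have := L0_ofE I (measurable_wstep (fun i => r * a i + b i)).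
apply: filterS5 => t e1 e2 e3 e4 e5 _; rewrite e5 e4 [LHS]e1 e2 e3.
rewrite mulrCA -mulrDr; congr (_ * _).
have [[k _ Jt]|Jt] := pselect ((\bigcup_n J n) t).
  by rewrite !(stepE _ Jt) mulrDl mulrA.
by rewrite !stepE0// mulr0 addr0.
Qed.

Definition trunc_seq n (a : nat -> R) i : R := if (i < n)%N then a i else 0.
Definition unit_seq n (i : nat) : R := (i == n)%:R.

Lemma wstep_trunc n a : wstep (trunc_seq n a) = \sum_(i < n) a i *: wstep (unit_seq i).
Proof.
elim: n => [|n IH].
  rewrite big_ord0.
  have := wstep_lin (-1) (trunc_seq 0 a) (trunc_seq 0 a).
  rewrite scaleN1r addNr => <-; congr wstep; apply/funext => i.
  by rewrite mulN1r addNr.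
rewrite big_ord_recr/= -IH addrC -wstep_lin; congr wstep; apply/funext => i.
rewrite /trunc_seq /unit_seq ltnS; case: ltngtP => [_|_|->].
by rewrite mulr0 add0r.
by rewrite mulr0 add0r.
by rewrite mulr1 addr0.
Qed.

Let B := \bigcup_n J n.

Let mB : measurable (B : set (measurableTypeR R)).
Proof. exact: bigcup_measurable. Qed.

Let wint_measurable (f : @L0 R I) :
  measurable_fun [set: measurableTypeR R] (fun t => (if T is Cesaro then 1 else t `^ (-1)) * f t).
Proof.
apply: measurable_funM; last exact: measurable_L0.
by case: T; [exact: measurable_cst|exact: measurable_powR].
Qed.

Let hwt_pos (t : R) : 0 < t -> 0 < hwt T t.
Proof. by rewrite /hwt; case: T => //= t0; rewrite invr_gt0. Qed.

Lemma measurable_window_int k (f : @L0 R I) :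
  measurable_fun (J k : set (measurableTypeR R)) (fun t => hwt T t * f t).
Proof.
apply: eq_measurable_fun (measurable_funTS (wint_measurable f)) => t.
by rewrite inE => /Jpos t0; rewrite hwt_powR// ltW.
Qed.

Lemma wmass_wstep_piece a k : wmass T (wstep a) (J k) = `|a k|%:E.
Proof.
rewrite /wmass (@ae_eq_integral _ _ _ mu _ (cst (`|a k| / len k)%:E)).
- by rewrite integral_cst// [X in (_ * X)%E]lenE -EFinM divfK// gt_eqF.
- exact: mJ.
- apply: (eq_measurable_fun (fun t => `|hwt T t * wstep a t|%:E)).
    by move=> t; rewrite inE => /Jpos/hwt_pos t0; rewrite normrM gtr0_norm.
  apply/measurable_EFinP; apply: measurableT_comp => //.
  exact: measurable_window_int.
- exact: measurable_cst.
- move: (wstepE a k); apply: (@filterS _ _ (ae_filter_ringOfSetsType mu)) => t wt Jt.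
  have t0 := hwt_pos (Jpos Jt).
  by rewrite -[hwt T t](gtr0_norm t0) -normrM wt// normrM normfV [`|len k|]gtr0_norm.
Qed.

Lemma wmass_bigcup (c0 : R) (f : @L0 R I) : B `<=` hdom I T c0 ->
  wmass T f B = (\sum_(0 <= k <oo) wmass T f (J k))%E.
Proof.
move=> Bc0; apply: ge0_integral_bigcup => //.
  exact: measurable_wint Bc0.
by move=> t; exact: wmass_hint_ge0 Bc0.
Qed.

(** Countable additivity of the integral: [wstep] is an isometry of l1 into the
    weighted L1 space. *)
Lemma wmass_wstep (c0 : R) (a : nat -> R) : B `<=` hdom I T c0 -> cvgn (series (fun n => `|a n|)) ->
  wmass T (wstep a) B = (limn (series (fun n => `|a n|)))%:E.
Proof.
move=> Bc0 ca; rewrite (wmass_bigcup _ Bc0).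
rewrite (eq_eseriesr (fun k _ => wmass_wstep_piece a k)) -EFin_lim//.
by congr (limn _); apply/funext => n /=; rewrite sumEFin.
Qed.

Definition piece_int (k : nat) (f : @L0 R I) : R := Rintegral mu (J k) (fun t => hwt T t * f t).

Let piece_integrable k (f : @L0 R I) : (wmass T f (J k) < +oo)%E ->
  mu.-integrable (J k) (EFin \o (fun t => hwt T t * f t)).
Proof.
move=> fin; apply/integrableP; split.
  by apply/measurable_EFinP; exact: measurable_window_int.
rewrite (le_lt_trans _ fin)// le_eqVlt; apply/orP; left; apply/eqP.
apply: eq_integral => t; rewrite inE => /Jpos/hwt_pos t0.
by rewrite /= normrM gtr0_norm.
Qed.

Lemma piece_int_le k (f : @L0 R I) : (wmass T f (J k) < +oo)%E ->
  (`|piece_int k f|%:E <= wmass T f (J k))%E.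
Proof.
move=> fin; have intf := piece_integrable fin.
have := le_normr_Rintegral (mJ k) intf; rewrite -lee_fin => /le_trans; apply.
rewrite le_eqVlt; apply/orP; left; apply/eqP.
rewrite /Rintegral; have -> : (\int[mu]_(t in J k) `|hwt T t * f t|%:E = wmass T f (J k))%E.
  apply: eq_integral => t; rewrite inE => /Jpos/hwt_pos t0.
  by rewrite normrM gtr0_norm.
rewrite fineK// ge0_fin_numE//; apply: integral_ge0 => t /Jpos/hwt_pos t0.
by rewrite lee_fin mulr_ge0// ltW.
Qed.

Lemma piece_int_lin k r (f g : @L0 R I) :
  (wmass T f (J k) < +oo)%E -> (wmass T g (J k) < +oo)%E ->
  piece_int k (r *: f + g) = r * piece_int k f + piece_int k g.
Proof.
move=> /piece_integrable intf /piece_integrable intg.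
have intrf : mu.-integrable (J k) (EFin \o (fun t => r * (hwt T t * f t))).
  by have := integrableZl (mJ k) r intf; apply: eq_integrable.
rewrite /piece_int -RintegralZl// -RintegralD//.
rewrite /Rintegral; congr fine; apply: ae_eq_integral => //.
- by apply/measurable_EFinP; exact: measurable_window_int.
- apply/measurable_EFinP; apply: measurable_funD; last exact: measurable_window_int.
  by apply: measurable_funM => //; exact: measurable_window_int.
- have /ae_dom := L0DE (r *: f) g; have /ae_dom := L0ZE r f.
  apply: filterS2 => t e1 e2 /Jdom It; rewrite e2// e1//.
  by rewrite mulrDr mulrCA.
Qed.

Lemma piece_int_wstep k a : piece_int k (wstep a) = a k.
Proof.
rewrite /piece_int /Rintegral (@ae_eq_integral _ _ _ mu _ (cst (a k / len k)%:E)).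
- by rewrite integral_cst// [X in (_ * X)%E]lenE -EFinM divfK// gt_eqF.
- exact: mJ.
- by apply/measurable_EFinP; exact: measurable_window_int.
- exact: measurable_cst.
- move: (wstepE a k); apply: (@filterS _ _ (ae_filter_ringOfSetsType mu)) => t wt Jt.
  by rewrite /= wt.
Qed.

Lemma sum_piece_int_le (c0 : R) n (f : @L0 R I) : B `<=` hdom I T c0 -> (wmass T f B < +oo)%E ->
  \sum_(k < n) `|piece_int k f| <= fine (wmass T f B).
Proof.
move=> Bc0 fin; have w0 := wmass_ge0 f Bc0.
have Jk_le k : (wmass T f (J k) <= wmass T f B)%E.
  apply: ge0_subset_integral => //; first exact: measurable_wint Bc0.
    by move=> t; exact: wmass_hint_ge0 Bc0.
  exact: bigcup_sup.
rewrite -lee_fin fineK ?ge0_fin_numE// (wmass_bigcup _ Bc0).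
apply: le_trans (nneseries_lim_ge n _); last first.
  move=> k _ _; apply: (@wmass_ge0 R I T c0).
  by apply: subset_trans Bc0; exact: bigcup_sup.
rewrite -sumEFin big_mkord; apply: lee_sum => k _; apply: piece_int_le.
exact: le_lt_trans fin.
Qed.

End step_functions.

(** * The copy of l1 over a window *)

Section disjoint_intervals.
Local Open Scope ring_scope.
Context {R : realType} (p q : R).
Notation mu := (@lebesgue_measure R).

(** Disjoint intervals inside [p, q] that accumulate at [p]; any sequence of disjoint
    sets of positive measure in the window would do. *)
Definition shell (n : nat) : set R :=
  `]p + (q - p) / n.+2%:R, p + (q - p) / n.+1%:R[%classic.

Hypothesis pq : p < q.

Let qp0 : 0 < q - p. Proof. by rewrite subr_gt0. Qed.

Lemma shell_sub n : shell n `<=` `]p, q[.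
Proof.
move=> t; rewrite /shell /= !in_itv/= => /andP[lt tu]; apply/andP; split.
  by apply: le_lt_trans lt; rewrite lerDl divr_ge0// ltW.
apply: lt_le_trans tu _; rewrite -lerBrDl ler_pdivrMr//.
by rewrite ler_peMr ?ler1n// ltW.
Qed.

Lemma trivIset_shell : trivIset setT shell.
Proof.
have lt i j t : shell i t -> shell j t -> (i < j)%N -> False.
  rewrite /shell /= !in_itv/= => /andP[it _] /andP[_ tj] ij.
  have := lt_trans it tj; rewrite ltrD2l ltr_pM2l// ltf_pV2 ?posrE// ltr_nat.
  by rewrite ltnNge ltnS ij.
move=> i j _ _ [t [ti tj]].
by case: (ltngtP i j) => // ij; case: (lt _ _ t _ _ ij).
Qed.

Lemma shell_measure n : (0 < mu (shell n) < +oo)%E.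
Proof.
have lt : p + (q - p) / n.+2%:R < p + (q - p) / n.+1%:R.
  by rewrite ltrD2l ltr_pM2l// ltf_pV2 ?posrE// ltr_nat.
by rewrite lebesgue_measure_itv/= lte_fin lt -EFinB lte_fin subr_gt0 lt ltry.
Qed.

End disjoint_intervals.

Lemma limn_unit_seq {R : realType} n :
  series (fun i => `|unit_seq n i : R|)%R @ \oo --> (1%R : R).
Proof.
apply: cvg_near_cst; near=> m; have nm : (n < m)%N by near: m; exact: nbhs_infty_gt.
rewrite /series/= (bigD1_seq n) ?mem_index_iota ?iota_uniq//=.
rewrite /unit_seq eqxx normr1 big1 ?addr0// => i /negbTE ->.
by rewrite normr0.
Unshelve. all: by end_near. Qed.

Section window_copy.
Local Open Scope ring_scope.
Context {R : realType} (I : domain) (T : hardy_op) (X : banachFunctionSpace R I).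
Context (c0 c1 : R) (J : nat -> set R).
Notation Y := (derived_space T X).
Notation B := (\bigcup_n J n).
Notation n0 := (nsub_norm X (kern I T c0)).
Notation n1 := (nsub_norm X (kern I T c1)).
Hypothesis mJ : forall n, measurable (J n : set (measurableTypeR R)).
Hypothesis tJ : trivIset setT J.
Hypothesis J0 : forall n, (0 < (@lebesgue_measure R) (J n) < +oo)%E.
Hypothesis Jpos : forall n t, J n t -> 0 < t.
Hypothesis Jc0 : forall n t, J n t -> hdom I T c0 t.
Hypothesis Jc1 : forall n t, J n t -> hdom I T t c1.
Hypothesis Ic0 : dom I c0.
Hypothesis Ic1 : dom I c1.
Hypothesis Xc0 : nsub_set X (kern I T c0).
Hypothesis Xc1 : nsub_set X (kern I T c1).
Hypothesis n0_gt0 : 0 < n0.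

Let Jdom n : J n `<=` dom I.
Proof. by move=> t /Jc0/(hdom_dom Ic0). Qed.

Let Bc0 : B `<=` hdom I T c0.
Proof. by move=> t [n _ /Jc0]. Qed.

Let mB : measurable (B : set (measurableTypeR R)).
Proof. exact: bigcup_measurable. Qed.

Let n1_gt0 : 0 < n1.
Proof.
have [t Jt] : exists t, J 0%N t.
  apply/set0P/eqP => JE; have := J0 0%N.
  by rewrite JE measure0 ltxx.
apply: (lt_le_trans n0_gt0).
by have [] := kern_norm_le Ic0 (hdom_trans (Jc0 Jt) (Jc1 Jt)) Xc1.
Qed.

Let wstep_bound (a : nat -> R) : cvgn (series (fun n => `|a n|)) ->
  Tset T X (wstep I T mJ tJ a) /\
  Tnorm T X (wstep I T mJ tJ a) <= limn (series (fun n => `|a n|)) * n1.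
Proof.
move=> ca; apply: (Tnorm_le_wmass Ic0 Ic1 Xc1 mB Bc0).
- by move=> t [n _ /Jc1].
- exact: (wstepE0 I T mJ tJ a).
- exact: (wmass_wstep mJ tJ J0 Jdom Jpos Bc0 ca).
Qed.

Lemma wstep_Tset (a : nat -> R) : cvgn (series (fun n => `|a n|)) ->
  nsub_set Y (wstep I T mJ tJ a).
Proof. by case/wstep_bound. Qed.

Lemma wstep_Tnorm (a : nat -> R) : cvgn (series (fun n => `|a n|)) ->
  nsub_norm Y (wstep I T mJ tJ a) <= limn (series (fun n => `|a n|)) * n1.
Proof. by case/wstep_bound. Qed.

(** The factor makes the map from l1 to T X contractive, since functions over the
    window are stretched by at most [n1]. *)
Definition wstep_elt (a : nat -> R) (ca : cvgn (series (fun n => `|a n|))) : space_of Y :=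
  n1^-1 *: (exist _ (wstep I T mJ tJ a) (mem_set (wstep_Tset ca)) : space_of Y).

Lemma wstep_eltE a ca : val (@wstep_elt a ca) = n1^-1 *: wstep I T mJ tJ a.
Proof. exact: linearZ. Qed.

Lemma wstep_elt_norm a ca : `|@wstep_elt a ca| <= limn (series (fun n => `|a n|)).
Proof.
rewrite normrZ ger0_norm ?invr_ge0 ?(ltW n1_gt0)// ler_pdivrMl// [leRHS]mulrC.
exact: wstep_Tnorm.
Qed.

Definition l1_vector n : space_of Y := wstep_elt (cvgP _ (limn_unit_seq n)).

Definition l1_coef k (u : space_of Y) : R := n1 * piece_int T J k (val u).

Lemma l1_vector_norm n : `|l1_vector n| <= 1.
Proof.
apply: (le_trans (wstep_elt_norm _)).
by rewrite (cvg_lim _ (limn_unit_seq n)).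
Qed.

Let window_mass (u : space_of Y) : (wmass T (val u) B < +oo)%E /\
  n0 * fine (wmass T (val u) B) <= `|u|.
Proof.
have [] := Tnorm_ge_wmass Ic0 Xc0 n0_gt0 mB Bc0 (space_ofP u).
by rewrite ge0_fin_numE// (wmass_ge0 _ Bc0).
Qed.

Let piece_mass (u : space_of Y) k : (wmass T (val u) (J k) < +oo)%E.
Proof.
apply: le_lt_trans (window_mass u).1; apply: ge0_subset_integral => //.
- exact: measurable_wint Bc0.
- by move=> t; exact: wmass_hint_ge0 Bc0.
- exact: bigcup_sup.
Qed.

Lemma l1_coef_linear k : linear (l1_coef k : space_of Y -> R^o).
Proof.
move=> r u v; rewrite /l1_coef (_ : val (r *: u + v) = r *: val u + val v) ?linearP//.
by rewrite (piece_int_lin mJ Jdom Jpos)// mulrDr mulrCA.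
Qed.

Lemma l1_coef_vector i j : l1_coef i (l1_vector j) = (i == j)%:R.
Proof.
rewrite (@biorthZ _ _ l1_coef l1_coef_linear) /l1_coef/= piece_int_wstep//.
by rewrite mulKf// gt_eqF.
Qed.

Lemma l1_coef_bound r n u : r * n1 <= n0 ->
  r * \sum_(k < n) `|l1_coef k u| <= `|u|.
Proof.
move=> rn; have [fin le] := window_mass u.
rewrite (_ : \sum_(_ < _) _ = n1 * \sum_(k < n) `|piece_int T J k (val u)|).
  rewrite mulrA (le_trans _ le)// (le_trans (ler_wpM2r _ rn)) ?sumr_ge0//.
  rewrite ler_wpM2l ?(ltW n0_gt0)//.
  exact: (sum_piece_int_le mJ tJ Jpos n Bc0 fin).
by rewrite mulr_sumr; apply: eq_bigr => k _; rewrite normrM gtr0_norm.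
Qed.

(** The difference between [wstep a] and a partial sum is [wstep] of a remainder of
    [a], so that its norm is at most the l1 norm of that remainder. *)
Lemma l1_series_cvg (a : nat -> R) : cvgn (series (fun n => `|a n|)) ->
  cvgn (series (fun n => a n *: l1_vector n)).
Proof.
move=> ca; pose s := limn (series (fun n => `|a n|)).
(* The remainder of a, in the shape required by linearity of wstep. *)
pose tail n i : R := -1 * trunc_seq n a i + a i.
have tail_cvg n : series (fun i => `|tail n i|) @ \oo --> s - series (fun i => `|a i|) n.
  have cas : (series (fun i => `|a i|) m - series (fun i => `|a i|) n)
      @[m --> \oo] --> s - series (fun i => `|a i|) n.
    by apply: (@cvgB R R^o); [exact: ca|exact: cvg_cst].
  apply: cvg_trans cas; apply: near_eq_cvg; near=> m.
  have nm : (n <= m)%N by near: m; exact: nbhs_infty_ge.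
  rewrite /series/= !(big_cat_nat (leq0n n) nm)/= addrAC subrr add0r.
  rewrite [X in _ = X + _]big1_seq ?add0r; last first.
    move=> i /andP[_]; rewrite mem_index_iota => /andP[_ ni].
    by rewrite /tail /trunc_seq ni mulN1r addNr normr0.
  rewrite big_nat [RHS]big_nat; apply: eq_bigr => i /andP[ni _].
  by rewrite /tail /trunc_seq ltnNge ni/= mulr0 add0r.
have series_tail n : wstep_elt ca - series (fun n => a n *: l1_vector n) n =
    wstep_elt (cvgP _ (tail_cvg n)).
  apply: val_inj; rewrite raddfB [series _ _]big_mkord raddf_sum [RHS]wstep_eltE.
  rewrite wstep_lin// scaleN1r addrC scalerDr; congr (_ + _).
  rewrite wstep_trunc scalerN scaler_sumr; congr (- _); apply: eq_bigr => i _.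
  rewrite [LHS]linearZ scalerA mulrC -scalerA; congr (_ *: _).
apply/cvg_ex; exists (wstep_elt ca); apply/cvgrPdist_le => eps eps0.
have : s - series (fun i => `|a i|) n @[n --> \oo] --> (0 : R).
  by rewrite -[X in _ --> X](subrr s); apply: (@cvgB R R^o) => //; exact: cvg_cst.
move=> /cvgrPdist_le/(_ _ eps0); apply: filterS => n.
rewrite sub0r normrN => le; rewrite series_tail (le_trans (wstep_elt_norm _))//.
by rewrite (cvg_lim _ (tail_cvg n))// (le_trans _ le)// ler_norm.
Unshelve. all: by end_near. Qed.

End window_copy.

Section conclusion.
Local Open Scope ring_scope.
Context {R : realType} (I : domain) (T : hardy_op) (X : banachFunctionSpace R I).
Notation Y := (derived_space T X).

(** The intervals [shell p q n] are placed inside a window given by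
    [exists_window]. *)
Lemma exists_biorthogonal (e : R) : 0 < e < 1 -> nsub_set Y <> [set 0] ->
  exists (x : nat -> space_of Y) (c : nat -> space_of Y -> R),
  [/\ forall n, `|x n| <= 1, forall n, linear (c n : space_of Y -> R^o),
    forall i j, c i (x j) = (i == j)%:R,
    forall n f, (1 - e) * \sum_(i < n) `|c i f| <= `|f| &
    forall a : nat -> R, cvgn (series (fun n => `|a n|)) ->
      cvgn (series (fun n => a n *: x n))].
Proof.
move=> /andP[e0 e1] Yn0.
have [f Yf fn0] : exists2 f : L0 I, Tset T X f & f <> 0.
  apply: contrapT => nex; apply: Yn0; apply/seteqP; split=> [f Yf|_ ->].
    by apply: contrapT => fn0; apply: nex; exists f.
  exact: nsub0.
have [p [q [c0 [c1 [[/andP[p0 pq] Ic0 Ic1 win] [Xc0 Xc1 n0 n01]]]]]] :=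
  exists_window e0 Yf fn0.
pose J := shell p q.
have mJ n : measurable (J n : set (measurableTypeR R)) by exact: measurable_itv.
have tJ : trivIset setT J := trivIset_shell pq.
have J0 n := shell_measure pq n.
have Jwin n t : J n t -> p < t < q by move=> /(shell_sub pq); rewrite /= in_itv.
have Jpos n t : J n t -> 0 < t by move=> /Jwin/andP[/(lt_trans p0)].
have Jc0 n t : J n t -> hdom I T c0 t by move=> /Jwin/win[].
have Jc1 n t : J n t -> hdom I T t c1 by move=> /Jwin/win[].
exists (l1_vector mJ tJ J0 Jpos Jc0 Jc1 Ic0 Ic1 Xc1), (@l1_coef R I T X c1 J).
split.
- by move=> n; exact: l1_vector_norm n0 _.
- move=> n; exact: (l1_coef_linear c1 mJ Jpos Jc0 Ic0 Xc0 n0).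
- by move=> i j; exact: (l1_coef_vector mJ tJ J0 Jpos Jc0 Jc1 Ic0 Ic1 Xc0 Xc1 n0).
- by move=> n u; exact: (l1_coef_bound mJ tJ J0 Jpos Jc0 Jc1 Ic0 Xc0 Xc1 n0).
- by move=> a ca; exact: (l1_series_cvg n0).
Qed.

End conclusion.

Theorem corollary4p3 (R : realType) (T : hardy_op) (I : domain)
    (X : banachFunctionSpace R I) :
  nsub_set (derived_space T X) <> [set 0%R] ->
  contains_complemented_almost_isometric_l1 (space_of (derived_space T X)) /\
  ~ reflexive_space (space_of (derived_space T X)).
Proof.
move=> Y0; split.
  move=> e e01; have [x [c [x1 c_lin cx c_bound x_cvg]]] := exists_biorthogonal e01 Y0.
  exists x; split.
    exact: biorthogonal_l1_almost_isometric e01 x1 c_lin cx c_bound x_cvg.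
  exact: biorthogonal_complemented e01 x1 c_lin cx c_bound x_cvg.
(* For nonreflexivity any copy of l1 will do. *)
have e01 : (0 < (2^-1 : R) < 1)%R by apply/andP; split; lra.
have [x [c [x1 c_lin cx c_bound x_cvg]]] := exists_biorthogonal e01 Y0.
exact: biorthogonal_nonreflexive e01 x1 c_lin cx c_bound.
Qed.
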